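(* Let $F:\mathbb R^n\to\mathbb R^n$ be given by an evaluation procedure, let $K\subset\mathbb R^n$ be a compact convex neighbourhood, let $\gamma_F$ be the second-order constant of $F$ on $K$, and let $\mathring x\in K$. Assume that the tangent piecewise linearization $\lozenge_{\mathring x}F:\mathbb R^n\to\mathbb R^n$ is composed of $k$ affine functions $F_1,\dots,F_k$ with invertible linear parts $A_1,\dots,A_k$, and put $\rho_F=\min\{1/\|A_1^{-1}\|,\dots,1/\|A_k^{-1}\|\}$. If $\lozenge_{\mathring x}F$ is coherently oriented, then all tangent mode piecewise linearizations $\lozenge_{\mathring z}F$ and all secant mode piecewise linearizations $\lozenge_{\check z}^{\hat z}F$ with development points ($\mathring z$, respectively $\check z,\hat z$) in $K\cap B(\mathring x,\rho_F/\gamma_F)$ are surjective onto $\mathbb R^n$.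
   Context: All norms are infinity norms (and the induced matrix norm); $B(x,r)$ is the open ball; $\rho_F/\gamma_F=+\infty$ if $\gamma_F=0$. A piecewise linear function composed of affine functions with linear parts $A_1,\dots,A_k$ is coherently oriented if all determinants $\det A_i$ have the same nonzero sign. Evaluation procedure. $F:\mathbb R^n\to\mathbb R^m$ (here $m=n$) is evaluated by a finite straight-line program: $v_{1-n},\dots,v_0$ are the components of $x$; for $i=1,\dots,l$ each $v_i$ is either $v_i=v_j+v_k$, or $v_i=|v_j|$, or $v_i=\varphi_i(v_j)$ with indices $j,k<i$, where each smooth univariate elemental $\varphi_i$ is defined on an open subset of $\mathbb R$ containing all values $v_j(x)$, and is differentiable there with locally Lipschitz derivative; the last $m$ values form $F(x)$. (Multiplications by constants are smooth univariate elementals; subtraction, product and quotient are rewritten using these, $u\cdot w=\tfrac14[(u+w)^2-(u-w)^2]$ and the reciprocal.) Secant model. For $\check x,\hat x$ put $\check v_i=v_i(\check x)$, $\hat v_i=v_i(\hat x)$, $\mathring v_i=(\check v_i+\hat v_i)/2$, $\mathring x=(\check x+\hat x)/2$. For $\Delta x\in\mathbb R^n$ define increments recursively: for the inputs, $\Delta v_{1-n},\dots,\Delta v_0$ are the components of $\Delta x$; $\Delta v_i=\Delta v_j+\Delta v_k$ if $v_i=v_j+v_k$; $\Delta v_i=c_{ij}\Delta v_j$ if $v_i=\varphi_i(v_j)$, with $c_{ij}=(\check v_i-\hat v_i)/(\check v_j-\hat v_j)$ if $\check v_j\ne\hat v_j$ and $c_{ij}=\varphi_i'(\mathring v_j)$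 otherwise; $\Delta v_i=|\mathring v_j+\Delta v_j|-\mathring v_i$ if $v_i=|v_j|$. The vector of the last $m$ increments is $\Delta F(\check x,\hat x;\Delta x)$, and $\lozenge_{\check x}^{\hat x}F(x)=\tfrac12(F(\check x)+F(\hat x))+\Delta F(\check x,\hat x;x-\mathring x)$ for $x\in\mathbb R^n$. Tangent model: $\lozenge_{\mathring x}F=\lozenge_{\mathring x}^{\mathring x}F$ (for an arbitrary point $\mathring x$). These models are continuous piecewise linear (piecewise affine) in $x$. Second-order constant $\gamma_F$ on $K$: start with $\beta_{x_i}=1,\gamma_{x_i}=0$ for the inputs; $\beta_v=\beta_u+\beta_w$, $\gamma_v=\gamma_u+\gamma_w$ if $v=u+w$; $\beta_v=\beta_u$, $\gamma_v=\gamma_u$ if $v=|u|$; $\beta_v=\beta_uL_K(\varphi)$, $\gamma_v=L_K(\varphi)\gamma_u+L_K(\varphi')\beta_u^2$ if $v=\varphi(u)$, where $L_K(\varphi)=\max_{x\in K}|\varphi'(u(x))|$ and $L_K(\varphi')$ is the Lipschitz constant of $\varphi'$ on $u(K)$; $\gamma_F$ is the maximum over the components of $F$. *)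

(* Defs.v *)
From HB Require Import structures.
From mathcomp Require Import all_boot all_order all_algebra.
From mathcomp Require Import all_classical all_reals all_analysis.

Set Implicit Arguments.
Unset Strict Implicit.
Unset Printing Implicit Defensive.

Import Order.TTheory GRing.Theory Num.Theory.
Import numFieldNormedType.Exports.

Local Open Scope classical_set_scope.
Local Open Scope ring_scope.

(* The values of [elem_fun] outside [elem_dom] are irrelevant: [admissible]
   below forces every evaluation to stay inside the domain. *)
Record elemental (R : realType) := Elemental {
  elem_fun :> R -> R ;
  elem_dom : set R ;
  elem_open : open elem_dom ;
  elem_derivable : forall t, elem_dom t -> derivable elem_fun t 1 ;
  elem_loclip : forall t, elem_dom t ->
    exists2 U : set R, nbhs t U & exists k : R, k.-lipschitz_U (derive1 elem_fun)
}.

(* [slp R n l] is the type of programs with n inputs and l instructions. Such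
   a program has l + n values v_{1-n}, ..., v_l, indexed from 0: the n inputs
   come first and each instruction appends one value at the end ([ord_max]). *)
Inductive slp (R : realType) (n : nat) : nat -> Type :=
| Inputs : slp R n 0
| Add l of slp R n l & 'I_(l + n) & 'I_(l + n) : slp R n l.+1
| Abs l of slp R n l & 'I_(l + n) : slp R n l.+1
| Smooth l of slp R n l & elemental R & 'I_(l + n) : slp R n l.+1.

Definition append (T : Type) (N : nat) (v : 'I_N -> T) (w : T) :
    'I_N.+1 -> T :=
  fun i => if unlift ord_max i is Some j then v j else w.

Fixpoint value (R : realType) (n l : nat) (p : slp R n l) (x : 'cV[R]_n) :
    'I_(l + n) -> R :=
  match p in slp _ _ l return 'I_(l + n) -> R with
  | Inputs => fun i => x i 0
  | Add _ q j k => append (value q x) (value q x j + value q x k)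
  | Abs _ q j => append (value q x) `|value q x j|
  | Smooth _ q phi j => append (value q x) (phi (value q x j))
  end.

Fixpoint admissible (R : realType) (n l : nat) (p : slp R n l) : Prop :=
  match p with
  | Inputs => True
  | Add _ q _ _ => admissible q
  | Abs _ q _ => admissible q
  | Smooth _ q phi j =>
      admissible q /\ forall x : 'cV[R]_n, elem_dom phi (value q x j)
  end.

(* The function F : R^n -> R^n computed by the program. Among l + n values,
   [rshift l] selects the last n. *)
Definition slp_fun (R : realType) (n l : nat) (p : slp R n l)
    (x : 'cV[R]_n) : 'cV[R]_n :=
  \col_i value p x (rshift l i).

Definition slope (R : realType) (phi : R -> R) (a b : R) : R :=
  if a != b then (phi a - phi b) / (a - b) else derive1 phi ((a + b) / 2).

Fixpoint increment (R : realType) (n l : nat) (p : slp R n l)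
    (xc xh dx : 'cV[R]_n) : 'I_(l + n) -> R :=
  match p in slp _ _ l return 'I_(l + n) -> R with
  | Inputs => fun i => dx i 0
  | Add _ q j k =>
      let dv := increment q xc xh dx in append dv (dv j + dv k)
  | Abs _ q j =>
      let dv := increment q xc xh dx in
      let vc := value q xc j in
      let vh := value q xh j in
      append dv (`|(vc + vh) / 2 + dv j| - (`|vc| + `|vh|) / 2)
  | Smooth _ q phi j =>
      let dv := increment q xc xh dx in
      append dv (slope phi (value q xc j) (value q xh j) * dv j)
  end.

Definition secant_model (R : realType) (n l : nat) (p : slp R n l)
    (xc xh x : 'cV[R]_n) : 'cV[R]_n :=
  2^-1 *: (slp_fun p xc + slp_fun p xh)
  + \col_i increment p xc xh (x - 2^-1 *: (xc + xh)) (rshift l i).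

Definition tangent_model (R : realType) (n l : nat) (p : slp R n l)
    (xo : 'cV[R]_n) : 'cV[R]_n -> 'cV[R]_n :=
  secant_model p xo xo.

Definition max_abs_deriv (R : realType) (n : nat) (K : set 'cV[R]_n)
    (phi : R -> R) (u : 'cV[R]_n -> R) : R :=
  sup [set `|derive1 phi (u x)| | x in K].

Definition lip_const_deriv (R : realType) (n : nat) (K : set 'cV[R]_n)
    (phi : R -> R) (u : 'cV[R]_n -> R) : R :=
  inf [set L : R | 0 <= L /\ L.-lipschitz_(u @` K) (derive1 phi)].

Fixpoint beta (R : realType) (n l : nat) (K : set 'cV[R]_n) (p : slp R n l) :
    'I_(l + n) -> R :=
  match p in slp _ _ l return 'I_(l + n) -> R with
  | Inputs => fun=> 1
  | Add _ q j k => append (beta K q) (beta K q j + beta K q k)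
  | Abs _ q j => append (beta K q) (beta K q j)
  | Smooth _ q phi j =>
      append (beta K q) (beta K q j * max_abs_deriv K phi (value q ^~ j))
  end.

Fixpoint gamma (R : realType) (n l : nat) (K : set 'cV[R]_n) (p : slp R n l) :
    'I_(l + n) -> R :=
  match p in slp _ _ l return 'I_(l + n) -> R with
  | Inputs => fun=> 0
  | Add _ q j k => append (gamma K q) (gamma K q j + gamma K q k)
  | Abs _ q j => append (gamma K q) (gamma K q j)
  | Smooth _ q phi j =>
      append (gamma K q)
        (max_abs_deriv K phi (value q ^~ j) * gamma K q j
         + lip_const_deriv K phi (value q ^~ j) * beta K q j ^+ 2)
  end.

(* All the gammas are nonnegative, so that 0 is a neutral default value. *)
Definition gamma_fun (R : realType) (n l : nat) (K : set 'cV[R]_n)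
    (p : slp R n l) : R :=
  \big[Num.max/0]_(i < n) gamma K p (rshift l i).

(* The norm on column vectors is the library one, i.e. the infinity norm; the
   library norm on ['M[R]_n] is the largest entry, not the induced norm. *)
Definition induced_norm (R : realType) (n : nat) (A : 'M[R]_n) : R :=
  sup [set `|A *m x| | x in [set x : 'cV[R]_n | `|x| <= 1]].

Definition composed_of (R : realType) (n k : nat) (G : 'cV[R]_n -> 'cV[R]_n)
    (A : 'I_k -> 'M[R]_n) (b : 'I_k -> 'cV[R]_n) : Prop :=
  forall x, exists i, G x = A i *m x + b i.

Definition coherently_oriented (R : realType) (n k : nat)
    (A : 'I_k -> 'M[R]_n) : Prop :=
  exists2 s : R, s != 0 & forall i, Num.sg (\det (A i)) = s.

(* A family of k + 1 matrices, so that the minimum is over a nonempty set. *)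
Definition rho (R : realType) (n k : nat) (A : 'I_k.+1 -> 'M[R]_n) : R :=
  \big[Num.min/(induced_norm (invmx (A ord0)))^-1]_i
    (induced_norm (invmx (A i)))^-1.

Definition quot_or_infty (R : realType) (r g : R) : \bar R :=
  if g == 0 then +oo%E else (r / g)%:E.

Definition eball (R : realType) (n : nat) (x : 'cV[R]_n) (r : \bar R) :
    set 'cV[R]_n :=
  [set z | (`|x - z|%:E < r)%E].

(* Main.v *)
(* Along the program one proves, for [d = max (|xo - zc|) (|xo - zh|)], that
   [|tangent_model xo x - secant_model zc zh x| <= gamma_F * d * |x| + C], while
   [|tangent_model xo x| >= rho * |x| - C']. Hence, when [gamma_F * d < rho], the
   two maps are homotopic through maps without zeros near infinity, and the
   tangent model has nonzero degree because all the preimages of a generic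
   value have the same sign. The degree argument is carried out by hand: for
   any map from the vertices of the Kuhn triangulation of a discrete torus to
   R^n in general position, the signed number of image simplices containing 0
   vanishes, since this count is the coboundary of the signed count of facets
   hit by a fixed ray. Applied to two maps which agree outside a ball, one
   affine with Jacobians of constant sign near its zeros and the other one
   without zeros, this is a contradiction. *)
Require Import Defs.
From HB Require Import structures.
From mathcomp Require Import all_boot all_order all_algebra all_fingroup.
From mathcomp Require Import all_classical all_reals all_analysis.
From mathcomp Require Import ring lra.

Set Implicit Arguments.
Unset Strict Implicit.
Unset Printing Implicit Defensive.

Import Order.TTheory GRing.Theory Num.Theory.
Import numFieldNormedType.Exports.

Local Open Scope classical_set_scope.
Local Open Scope ring_scope.

(** * Ray crossings of the facets of a simplex *)

(** A simplex that wraps around the torus joins far apart points, so its count says nothing about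
    zeros. The two maps agree at its vertices, hence only the difference of the two counts is used
    and such terms cancel. On any other simplex of a fine grid the map without zeros sends all
    vertices to one side of a coordinate hyperplane and contributes 0, while the other map
    contributes terms of one sign. A zero on a face shared by several simplices is then harmless: it
    suffices to know a single term exactly. The grid is placed so that a zero is the barycenter of
    one simplex, a position that survives the small perturbation needed for general position. Such a
    zero exists because the regular value is taken of the form [G x0]. The perturbation follows the
    moment curve, where Vandermonde determinants turn each degeneracy into a nonzero polynomial in
    its size. In the growth bounds only the coefficient of [|x|] matters: the additive constants
    absorb the rest, including the target value, so one argument serves all targets. *)

Lemma sum_crossings_pos (R : realFieldType) m (c t : 'I_m -> R) :
  (forall k, c k != 0) -> injective t ->
  \sum_(k | 0 < c k) [forall j, (j != k) ==> (0 < (t k - t j) * c j)]%:R =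
  ([exists k, 0 < c k] &&
   [forall i, forall j, (0 < c i) && (c j < 0) ==> (t i < t j)])%:R :> R.
Proof.
move=> c0 tI; have [/existsP[k0 ck0]|/existsPn nc] := boolP [exists k, 0 < c k];
  last by rewrite big_pred0 // => k; exact/negbTE/nc.
(* Only the largest [t] among the indices with [c > 0] can contribute: a larger [t j] with [c j > 0]
   makes the product at [j] negative. *)
have [p cp pmax] := @Order.TotalTheory.arg_maxP _ _ _ k0 (fun k => 0 < c k) t ck0.
have {}pmax k : 0 < c k -> t k <= t p by exact: pmax.
rewrite (bigD1 p) //= big1 ?addr0 => [|k /andP[ck kp]]; last first.
  case: forallP => // /(_ p); rewrite eq_sym kp /= pmulr_lgt0 // subr_gt0.
  by rewrite ltNge pmax.
congr _%:R; congr nat_of_bool; apply/idP/idP.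
  move=> /forallP h; apply/forallP => i; apply/forallP => j.
  apply/implyP => /andP[ci cj]; apply: (le_lt_trans (pmax _ ci)).
  have jp : j != p by apply: contraTneq cj => ->; rewrite -leNgt ltW.
  by move: (h j); rewrite jp /= nmulr_lgt0 // subr_lt0.
move=> /forallP h; apply/forallP => j; apply/implyP => jp.
have [cj|cj|cj] := ltgtP (c j) 0; last by move: (c0 j); rewrite cj eqxx.
  rewrite nmulr_lgt0 // subr_lt0; have /forallP/(_ j) := h p.
  by rewrite cp cj.
rewrite pmulr_lgt0 // subr_gt0 lt_neqAle pmax // andbT.
by apply: contraNneq jp => /tI ->.
Qed.

(* On the line [mu + s c], the points where some coordinate [k] vanishes and all
   others are positive are the ends of the interval where no coordinate is
   negative; a left end has [c k > 0], a right end has [c k < 0]. *)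
Lemma sum_crossings (R : realFieldType) m (c t : 'I_m -> R) :
  (forall k, c k != 0) -> injective t ->
  \sum_k Num.sg (c k) *
     [forall j, (j != k) ==> (0 < (t k - t j) * c j)]%:R =
  (0 < m)%:R * ([forall k, 0 < c k]%:R - [forall k, c k < 0]%:R) :> R.
Proof.
move=> c0 tI; have nc0 k : - c k != 0 by rewrite oppr_eq0.
have ntI : injective (fun k => - t k) by move=> i j /oppr_inj /tI.
(* Negating both [c] and [t] reverses the line and turns right ends into left ends, so the same
   count applies to both. *)
have hpos := sum_crossings_pos c0 tI; have hneg := sum_crossings_pos nc0 ntI.
have -> : \sum_k Num.sg (c k) *
     [forall j, (j != k) ==> (0 < (t k - t j) * c j)]%:R =
     ([exists k, 0 < c k] &&
   [forall i, forall j, (0 < c i) && (c j < 0) ==> (t i < t j)])%:R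
   - ([exists k, c k < 0] &&
   [forall i, forall j, (0 < c i) && (c j < 0) ==> (t i < t j)])%:R :> R.
  rewrite -hpos (bigID (fun k => 0 < c k)) /=; congr (_ + _).
    by apply: eq_bigr => k ck; rewrite gtr0_sg // mul1r.
  transitivity (- (\sum_(k | 0 < - c k)
    [forall j, (j != k) ==> (0 < (- t k - - t j) * - c j)]%:R) : R).
    rewrite -sumrN; apply: eq_big => [k|k ck].
      by rewrite oppr_gt0 -leNgt le_eqVlt (negbTE (c0 k)).
    have {}ck : c k < 0 by rewrite lt_neqAle c0 leNgt.
    rewrite ltr0_sg // mulN1r; congr (- _%:R); congr nat_of_bool.
    by apply: eq_forallb => j; rewrite mulrN -mulNr opprB opprK addrC.
  rewrite hneg; congr (- (_ && _)%:R).
    by apply: eq_existsb => k; rewrite oppr_gt0.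
  apply/forallP/forallP => h i; apply/forallP => j; apply/implyP => /andP[].
    rewrite -oppr_lt0 -[c j < 0]oppr_gt0 => ci cj.
    by have /forallP/(_ i) := h j; rewrite ci cj /= ltrN2.
  rewrite oppr_gt0 oppr_lt0 ltrN2 => ci cj.
  by have /forallP/(_ i) := h j; rewrite ci cj.
(* If both signs occur, the two ends are both present or both absent and cancel; if one sign occurs,
   the interval is a half line with exactly one end. *)
have [/existsP[p cp]|/existsPn np] := boolP [exists k, 0 < c k];
  have [/existsP[q cq]|/existsPn nq] := boolP [exists k, c k < 0].
- have -> : [forall k, 0 < c k] = false.
    by apply/forallP => /(_ q); rewrite ltNge ltW.
  have -> : [forall k, c k < 0] = false.
    by apply/forallP => /(_ p); rewrite ltNge ltW.
  by rewrite !subrr mulr0.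
- have -> : [forall k, 0 < c k].
    by apply/forallP => k; rewrite lt_neqAle eq_sym c0 leNgt nq.
  have -> : [forall k, c k < 0] = false.
    by apply/forallP => /(_ p); rewrite ltNge ltW.
  rewrite (leq_ltn_trans _ (ltn_ord p)) // mul1r.
  suff -> : [forall i, forall j, (0 < c i) && (c j < 0) ==> (t i < t j)] by [].
  apply/forallP => i; apply/forallP => j.
  by rewrite (negbTE (nq j)) andbF.
- have -> : [forall k, 0 < c k] = false.
    by apply/forallP => /(_ q); rewrite ltNge ltW.
  have -> : [forall k, c k < 0].
    by apply/forallP => k; rewrite lt_neqAle c0 leNgt np.
  rewrite (leq_ltn_trans _ (ltn_ord q)) // mul1r.
  suff -> : [forall i, forall j, (0 < c i) && (c j < 0) ==> (t i < t j)] by [].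
  apply/forallP => i; apply/forallP => j.
  by rewrite (negbTE (np i)).
- case: m c t c0 tI nc0 ntI hpos hneg np nq => [|m] c t c0 _ _ _ _ _ np nq.
    by rewrite mul0r subrr.
  by have := c0 ord0; rewrite neq_lt (negbTE (np ord0)) (negbTE (nq ord0)).
Qed.

(** The cofactors along a row put on top of [V]. They form a linear dependency between the columns
    of [V]; divided by [\det (col_mx (const_mx 1) V)], when this is nonzero, they are the
    barycentric coordinates of 0. *)
Definition facet_coef (R : comNzRingType) n (V : 'M[R]_(n, n.+1)) (k : 'I_n.+1) : R :=
  (-1) ^+ k * \det (col' k V).

Lemma facet_coef_cofactor (R : comNzRingType) n (r : 'rV[R]_n.+1)
    (V : 'M[R]_(n, n.+1)) k :
  cofactor (col_mx r V : 'M[R]_(1 + n)) ord0 k = facet_coef V k.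
Proof.
rewrite /cofactor /facet_coef add0n; congr (_ * \det _).
by apply/matrixP => i j; rewrite 2!mxE [RHS]mxE -rshift1 col_mxEd.
Qed.

Lemma sum_facet_coef (R : comNzRingType) n (r : 'rV[R]_n.+1) (V : 'M[R]_(n, n.+1)) :
  \sum_k r 0 k * facet_coef V k = \det (col_mx r V : 'M[R]_(1 + n)).
Proof.
rewrite (expand_det_row _ ord0); apply: eq_bigr => k _.
rewrite facet_coef_cofactor; congr (_ * _).
by rewrite -(col_mxEu r V 0 k); congr (fun_of_matrix _ _ _); apply: val_inj.
Qed.

Lemma sum_facet_coef_row (R : comNzRingType) n (V : 'M[R]_(n, n.+1)) i :
  \sum_k V i k * facet_coef V k = 0.
Proof.
have -> : \sum_k V i k * facet_coef V k = \sum_k row i V 0 k * facet_coef V k.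
  by apply: eq_bigr => k _; rewrite mxE.
rewrite sum_facet_coef; apply: (determinant_alternate (i1 := lshift n 0) (i2 := rshift 1 i)).
  by rewrite eq_lrshift.
by move=> j; rewrite col_mxEu col_mxEd mxE.
Qed.

(** For invertible [F], the second factor tells whether the ray from 0 through [u] lies in the open
    cone over the columns of [F]. *)
Definition crossing (R : realFieldType) n (u : 'cV[R]_n) (F : 'M[R]_n) : R :=
  Num.sg (\det F) * [forall i, 0 < (invmx F *m u) i 0]%:R.

(** The orientation sign of the simplex on the columns of [V] if 0 is in its interior, and 0
    otherwise: the barycentric coordinates of 0 are the [facet_coef] up to a common factor. *)
Definition zero_side (R : realFieldType) n (V : 'M[R]_(n, n.+1)) : R :=
  [forall k, 0 < facet_coef V k]%:R - [forall k, facet_coef V k < 0]%:R.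

(** The solutions of [V *m mu = u] form a line directed by the facet coefficients. A facet is
    crossed by the ray where this line meets the boundary of the positive orthant, so
    [sum_crossings] applies. *)
Lemma sum_facet_crossing (R : realFieldType) n (u : 'cV[R]_n) (V : 'M[R]_(n, n.+1)) :
  (forall k, \det (col' k V) != 0) ->
  (forall k i, (invmx (col' k V) *m u) i 0 != 0) ->
  \sum_(k < n.+1) (-1) ^+ k * crossing u (col' k V) = zero_side V.
Proof.
move=> F0 x0; pose c := facet_coef V; pose x k := invmx (col' k V) *m u.
have c0 k : c k != 0 by rewrite mulf_neq0 ?signr_eq0.
have Fx k : col' k V *m x k = u.
  by rewrite /x mulKVmx // unitmxE unitfE.
(* [mu k] is the solution whose coordinate [k] vanishes: it writes [u] in terms of the facet [k]. *)
pose mu k j := if unlift k j is Some j' then x k j' 0 else 0.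
have mu_k k : mu k k = 0 by rewrite /mu unlift_none.
have mu_l k j : mu k (lift k j) = x k j 0 by rewrite /mu liftK.
have Vmu k i : \sum_j V i j * mu k j = u i 0.
  rewrite (bigD1_ord k) //= mu_k mulr0 add0r -[RHS](congr1 (fun z : 'cV_n => z i 0) (Fx k)) mxE.
  by apply: eq_bigr => j _; rewrite mu_l !mxE.
(* The parameter at which coordinate [j] vanishes on the line [mu ord0 + s c]; hence [mu k] is the
   point of parameter [t k]. *)
pose t j := - mu ord0 j / c j.
have muE k j : mu k j = (t k - t j) * c j.
  pose w := \col_j' (mu ord0 (lift k j') + t k * c (lift k j') - x k j' 0).
  have w0 : w = 0.
    suff : col' k V *m w = 0.
      move=> /(congr1 (mulmx (invmx (col' k V)))).
      by rewrite mulKmx ?unitmxE ?unitfE // mulmx0.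
    apply/colP => i; rewrite !mxE.
    transitivity (\sum_j V i j * mu ord0 j + t k * (\sum_j V i j * c j)
                  - \sum_j V i j * mu k j); last first.
      by rewrite !Vmu sum_facet_coef_row mulr0 addr0 subrr.
    rewrite mulr_sumr -big_split -sumrB (bigD1_ord k) //= mu_k mulr0 subr0.
    rewrite [X in _ = X + _](_ : _ = 0) ?add0r; last first.
      have tc : t k * c k = - mu ord0 k by rewrite /t divfK.
      by rewrite [X in _ + X]mulrCA tc mulrN addrN.
    by apply: eq_bigr => j' _; rewrite mu_l !mxE; ring.
  have [->|jk] := eqVneq j k; first by rewrite mu_k subrr mul0r.
  move: jk; rewrite eq_sym => /unlift_some[j' -> _].
  rewrite mu_l; have /colP/(_ j') := w0; rewrite !mxE => /eqP.
  rewrite subr_eq0 => /eqP <-; rewrite mulrBl /t divfK //; ring.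
have tI : injective t.
  move=> j k tjk; apply/eqP/negPn/negP => jk.
  have [j' jE _] := unlift_some jk.
  by have := x0 j j'; rewrite -/(x j) -mu_l -jE muE tjk subrr mul0r eqxx.
transitivity (\sum_k Num.sg (c k) *
     [forall j, (j != k) ==> (0 < (t k - t j) * c j)]%:R).
  apply: eq_bigr => k _; rewrite /crossing mulrA; congr (_ * _).
    by rewrite /c /facet_coef sgrM sgrX sgrN1.
  congr _%:R; congr nat_of_bool; apply/forallP/forallP => [h j|h j'].
    apply/implyP; rewrite eq_sym => /unlift_some[j' -> _].
    by rewrite -muE mu_l; exact: h.
  by have := h (lift k j'); rewrite eq_sym neq_lift /= -muE mu_l.
by rewrite sum_crossings // mul1r.
Qed.

(** * The Kuhn triangulation of a discrete torus *)

(* A permutation [tau] lists, through [tau i < k], the coordinates already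
   raised at the [k]-th vertex of a simplex of the Kuhn triangulation; the
   lattice is taken modulo [N.+2] so that the triangulated space has no
   boundary. *)
Definition kuhn_vertex n N (x : {ffun 'I_n -> 'I_N.+2}) (tau : 'S_n) (k : nat) :
    {ffun 'I_n -> 'I_N.+2} :=
  x + [ffun i => (tau i < k)%:R].

(** The cycle sending 0 to the last position and lowering the others by one. The first coordinate
    raised becomes the last one raised in the neighbouring simplex. *)
Definition rotation n : 'S_n.+1 := lift_perm ord0 ord_max 1.

Lemma sum_sign_invariant (R : realFieldType) n (s : 'S_n) (g : 'S_n -> R) :
  odd_perm s -> (forall tau, g (tau * s)%g = g tau) ->
  \sum_(tau : 'S_n) (-1) ^+ tau * g tau = 0.
Proof.
move=> os gs; apply/eqP; rewrite -eqNr; apply/eqP.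
rewrite [RHS](reindex_inj (mulIg s)) /= -sumrN; apply: eq_bigr => tau _.
by rewrite odd_permM os addbT gs signrN mulNr.
Qed.

(** Exchanging two consecutive raises moves only the vertex between them, so the two simplices share
    the facet opposite to it. *)
Lemma kuhn_vertex_tperm n N (x : {ffun 'I_n -> 'I_N.+2}) (tau : 'S_n) (a b : 'I_n) (m : nat) :
  b = a.+1 :> nat -> m != b -> kuhn_vertex x (tau * tperm a b)%g m = kuhn_vertex x tau m.
Proof.
move=> ba mb; congr (_ + _); apply/ffunP => i; rewrite !ffunE permM.
have abm : (b < m)%N = (a < m)%N by rewrite ba ltn_neqAle -ba eq_sym mb.
by case: tpermP => [->|->|//]; rewrite abm.
Qed.

Lemma kuhn_vertex_rotation n N (x : {ffun 'I_n.+1 -> 'I_N.+2}) (tau : 'S_n.+1) (j : 'I_n.+1) :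
  kuhn_vertex (x + [ffun i => (tau i == 0)%:R]) (tau * rotation n)%g j =
  kuhn_vertex x tau j.+1.
Proof.
rewrite /kuhn_vertex -addrA; congr (_ + _); apply/ffunP => i; rewrite !ffunE permM.
have [->|] := eqVneq (tau i) ord0.
  by rewrite lift_perm_id /= ltnNge -ltnS ltn_ord /= addr0.
rewrite eq_sym => /unlift_some[m -> _].
have mn : (m < n)%N := ltn_ord m.
by rewrite add0r lift_perm_lift perm1 /= /bump (leqNgt n m) mn add0n add1n ltnS.
Qed.

(** Each facet occurs twice with opposite signs. Facets opposite a middle vertex cancel through a
    transposition; those opposite the first and the last vertex cancel through [rotation] and a
    translation, which is a bijection of the torus. *)
Lemma sum_kuhn_boundary (R : realFieldType) n N
    (Phi : {ffun 'I_n.+1 -> {ffun 'I_n.+1 -> 'I_N.+2}} -> R) :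
  \sum_x \sum_(tau : 'S_n.+1) (-1) ^+ tau *
    (\sum_(k < n.+2) (-1) ^+ k * Phi [ffun j => kuhn_vertex x tau (lift k j)]) = 0.
Proof.
pose S (k : 'I_n.+2) := \sum_x \sum_(tau : 'S_n.+1)
   (-1) ^+ tau * Phi [ffun j => kuhn_vertex x tau (lift k j)].
transitivity (\sum_(k < n.+2) (-1) ^+ k * S k).
  under eq_bigr do under eq_bigr do rewrite mulr_sumr.
  under eq_bigr do rewrite exchange_big.
  rewrite exchange_big /=; apply: eq_bigr => k _; rewrite mulr_sumr.
  by apply: eq_bigr => x _; rewrite mulr_sumr; apply: eq_bigr => tau _; rewrite mulrCA.
have Smid (k : 'I_n) : S (lift ord0 (widen_ord (leqnSn n) k)) = 0.
  rewrite /S big1 // => x _.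
  pose a := widen_ord (leqnSn n) k; pose b := lift ord0 k.
  apply: (@sum_sign_invariant _ _ (tperm a b)).
    by rewrite odd_tperm -val_eqE /= /bump add1n ltn_eqF.
  move=> tau; congr Phi; apply/ffunP => j; rewrite !ffunE.
  apply: kuhn_vertex_tperm => //.
  by rewrite [X in _ != X](_ : _ = lift ord0 a :> nat) // eq_sym; exact: neq_lift.
rewrite big_ord_recl big_ord_recr /= big1 ?add0r; last first.
  by move=> k _; rewrite Smid mulr0.
rewrite expr0 mul1r.
(* The rotation has sign [(-1) ^+ n], whereas the last facet carries [(-1) ^+ n.+1]. *)
have -> : S ord0 = (-1) ^+ n * S (lift ord0 ord_max).
  rewrite /S exchange_big [in RHS]exchange_big /=.
  rewrite [in RHS](reindex_inj (mulIg (rotation n))) mulr_sumr.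
  apply: eq_bigr => tau _.
  rewrite [in RHS](reindex_inj (addIr [ffun i => (tau i == 0)%:R])) mulr_sumr.
  apply: eq_bigr => x _; rewrite mulrA; congr (_ * Phi _).
    rewrite odd_permM odd_lift_perm odd_perm1 addbF /= signr_addb signr_odd.
    by rewrite mulrCA -expr2 sqrr_sign mulr1.
  apply/ffunP => j; rewrite !ffunE.
  rewrite [LHS](_ : _ = kuhn_vertex x tau j.+1) // -kuhn_vertex_rotation.
  by congr kuhn_vertex; rewrite /= /bump leqNgt ltn_ord.
by rewrite /= /bump leq0n add1n exprS mulN1r mulNr subrr.
Qed.

(** * General position *)

Definition kuhn_mx (R : pzRingType) n (tau : 'S_n) : 'M[R]_(n, n.+1) :=
  \matrix_(i, k) (tau i < k)%:R.

(** Below the row of ones, [tau] permutes the rows of the matrix of the identity, which is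
    unitriangular. *)
Lemma det_kuhn_mx (R : comNzRingType) n (tau : 'S_n) :
  \det (col_mx (const_mx 1) (kuhn_mx R tau) : 'M[R]_(1 + n)) = (-1) ^+ tau.
Proof.
have -> : col_mx (const_mx 1) (kuhn_mx R tau) =
    block_mx 1%:M 0 0 (perm_mx tau) *m col_mx (const_mx 1) (kuhn_mx R 1) :> 'M[R]_(1 + n, n.+1).
  rewrite mul_block_col mul1mx !mul0mx addr0 add0r -row_permE; congr col_mx.
  by apply/matrixP => i k; rewrite !mxE perm1.
rewrite det_mulmx det_ublock det1 mul1r det_perm -[RHS]mulr1; congr (_ * _).
rewrite -det_tr det_trig.
  apply: big1 => i _; rewrite mxE; case: (split_ordP i) => j ->.
    by rewrite col_mxEu mxE.
  by rewrite col_mxEd mxE perm1 /= add1n ltnSn.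
apply/is_trig_mxP => i j; rewrite mxE; case: (split_ordP j) => k ->.
  by rewrite ord1.
move=> /= ik; rewrite col_mxEd mxE perm1.
by rewrite (_ : (k < i)%N = false) //; apply/negbTE; rewrite -leqNgt; exact: ik.
Qed.

Lemma det_affine_kuhn_mx (R : comNzRingType) n (tau : 'S_n) (A : 'M[R]_n)
    (p b : 'cV[R]_n) (e : R) (V : 'M[R]_(n, n.+1)) :
  (forall k, col k V = A *m (p + e *: col k (kuhn_mx R tau)) + b) ->
  \det (col_mx (const_mx 1) V : 'M[R]_(1 + n)) = \det A * e ^+ n * (-1) ^+ tau.
Proof.
move=> VE.
have -> : col_mx (const_mx 1) V = block_mx 1%:M 0 (A *m p + b) (e *: A) *m
     col_mx (const_mx 1) (kuhn_mx R tau) :> 'M[R]_(1 + n, n.+1).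
  rewrite mul_block_col mul1mx mul0mx addr0; congr col_mx.
  apply/matrixP => i k; have /colP/(_ i) := VE k.
  rewrite mulmxDr -scalemxAr addrAC !mxE => ->; congr (_ + _).
    by rewrite big_ord1 !mxE mulr1.
  rewrite mulr_sumr; apply: eq_bigr => j _; rewrite !mxE; exact: mulrA.
rewrite det_mulmx det_kuhn_mx; congr (_ * _).
by rewrite det_lblock det1 mul1r detZ mulrC.
Qed.

Definition subst_col (R : nmodType) n (F : 'M[R]_n) (i : 'I_n) (u : 'cV[R]_n) : 'M[R]_n :=
  \matrix_(a, b) if b == i then u a 0 else F a b.

Lemma cramer (R : comPzRingType) n (F : 'M[R]_n) i (u : 'cV[R]_n) :
  (\adj F *m u) i 0 = \det (subst_col F i u).
Proof.
rewrite (expand_det_col _ i) mxE; apply: eq_bigr => j _.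
rewrite !mxE eqxx mulrC; congr (_ * (_ * \det _)).
by apply/matrixP => a b; rewrite !mxE eq_sym (negbTE (neq_lift _ _)).
Qed.

Lemma det_addZ_poly (R : comNzRingType) n (F E : 'M[R]_n) :
  exists p : {poly R}, forall d, \det (F + d *: E) = p.[d].
Proof.
exists (\det (map_mx polyC F + 'X *: map_mx polyC E)) => d.
rewrite -horner_evalE -det_map_mx; congr (\det _); apply/matrixP => i j.
by rewrite !mxE /= horner_evalE !hornerE.
Qed.

Section near_zero.
Variable R : realType.

Lemma sgr_det_addZ_near n (F E : 'M[R]_n) : \det F != 0 ->
  \forall d \near 0^'+, Num.sg (\det (F + d *: E)) = Num.sg (\det F).
Proof.
move=> F0; have [p pE] := det_addZ_poly F E.
have p0 : p.[0] = \det F by rewrite -pE scale0r addr0.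
have pc : p.[d] @[d --> 0^'+] --> p.[0].
  by apply: cvg_at_right_filter; exact: continuous_horner.
move: F0; rewrite -p0 neq_lt => /orP[pn|pp].
  near=> d; rewrite pE (ltr0_sg pn) ltr0_sg //; near: d.
  exact: (cvgr_lt _ pc).
near=> d; rewrite pE (gtr0_sg pp) gtr0_sg //; near: d.
exact: (cvgr_gt _ pc).
Unshelve. all: by end_near. Qed.

Lemma poly_near_neq0 (p : {poly R}) : p != 0 -> \forall d \near 0^'+, p.[d] != 0.
Proof.
move=> p0; have [m [q]] := multiplicity_XsubC p 0; rewrite p0 /= => q0 ->.
have qc : q.[d] @[d --> 0^'+] --> q.[0].
  by apply: cvg_at_right_filter; exact: continuous_horner.
near=> d; rewrite hornerM horner_exp hornerXsubC subr0 mulf_neq0 //.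
  by near: d; exact: (cvgr_neq0 _ qc).
rewrite expf_neq0 // gt_eqF //; near: d; exact: nbhs_right_gt.
Unshelve. all: by end_near. Qed.

Lemma det_addZ_near_neq0 n (F E : 'M[R]_n) : \det E != 0 ->
  \forall d \near 0^'+, \det (F + d *: E) != 0.
Proof.
move=> E0; have [p pE] := det_addZ_poly F E.
have [p0|p0] := eqVneq p 0; last first.
  by apply: filterS (poly_near_neq0 p0) => d; rewrite pE.
(* [q] is the reversed polynomial: [q.[d]] is [d ^+ n] times [p.[d^-1]] for nonzero [d], whereas
   [q.[0]] is [\det E]. *)
have [q qE] := det_addZ_poly E F.
have q0 : q != 0.
  by apply: contraNneq E0 => q0; rewrite -[E]addr0 -(scale0r F) qE q0 horner0.
exfalso; have := poly_near_neq0 q0 => qn.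
near (0 : R)^'+ => d.
have d0 : d != 0 by rewrite gt_eqF //; near: d; exact: nbhs_right_gt.
have : q.[d] != 0 by near: d.
rewrite -qE -[E](scalerK d0) scalerA mulrC -scalerA -scalerDr addrC detZ.
by rewrite pE p0 horner0 mulr0 eqxx.
Unshelve. all: by end_near. Qed.
End near_zero.

(** The moment curve: any [n] of its points with distinct parameters are linearly independent. *)
Definition moment (R : pzRingType) n (a : R) : 'cV[R]_n := \col_i a ^+ i.

Lemma det_moment_neq0 (R : idomainType) n (a : 'I_n -> R) : injective a ->
  \det (\matrix_(i, j) moment n (a j) i 0) != 0.
Proof.
move=> aI; have -> : \matrix_(i, j) moment n (a j) i 0 = Vandermonde n (\row_j a j).
  by apply/matrixP => i j; rewrite !mxE.
rewrite det_Vandermonde; apply/prodf_neq0 => i _; apply/prodf_neq0 => j ij.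
by rewrite !mxE subr_eq0; apply: contraTneq ij => /aI ->; rewrite ltnn.
Qed.

Definition generic (R : fieldType) n (u : 'cV[R]_n) (V : 'M[R]_(n, n.+1)) :=
  forall k, \det (col' k V) != 0 /\ forall i, (invmx (col' k V) *m u) i 0 != 0.

(** By Cramer's rule every condition is the nonvanishing of a determinant of the form [F + d *: E]
    with [E] a Vandermonde matrix; the parameter [a0] of the ray must differ from those of the
    vertices. *)
Lemma generic_near (R : realType) n (a : 'I_n.+1 -> R) (a0 : R) (V : 'M[R]_(n, n.+1)) :
  injective a -> (forall k, a k != a0) ->
  \forall d \near 0^'+,
    generic (moment n a0) (V + d *: \matrix_(i, k) moment n (a k) i 0).
Proof.
move=> aI aa0; set E := \matrix_(i, k) _; apply: filter_forall => k.
have colE d : col' k (V + d *: E) = col' k V + d *: col' k E.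
  by apply/matrixP => i j; rewrite !mxE.
have aIk : injective (a \o lift k) by move=> i j /aI /lift_inj.
have nD : \forall d \near (0 : R)^'+, \det (col' k V + d *: col' k E) != 0.
  apply: det_addZ_near_neq0; rewrite [X in \det X](_ : _ =
     \matrix_(i, j) moment n ((a \o lift k) j) i 0) ?det_moment_neq0 //.
  by apply/matrixP => i j; rewrite !mxE.
(* Column [i] of this matrix is [d *: u] instead of [u], which fits the form [F + d *: E] and only
   multiplies the determinant by [d]. *)
have nS : \forall d \near (0 : R)^'+, forall i,
    \det (subst_col (col' k V) i 0 + d *: subst_col (col' k E) i (moment n a0)) != 0.
  apply: filter_forall => i; apply: det_addZ_near_neq0.
  pose a' j := if j == i then a0 else a (lift k j).
  rewrite [X in \det X](_ : _ = \matrix_(i, j) moment n (a' j) i 0); last first.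
    by apply/matrixP => r j; rewrite !mxE /a'; case: eqP.
  apply: det_moment_neq0 => j1 j2; rewrite /a'.
  case: eqP => [->|_]; case: eqP => [->|_] //.
  - by move/eqP; rewrite eq_sym (negbTE (aa0 _)).
  - by move/eqP; rewrite (negbTE (aa0 _)).
  - exact: aIk.
near=> d; rewrite colE.
have D0 : \det (col' k V + d *: col' k E) != 0 by near: d.
split=> // i; rewrite /invmx unitmxE unitfE D0 -scalemxAl mxE mulf_neq0 ?invr_eq0 // cramer.
have d0 : 0 < d by near: d; exact: nbhs_right_gt.
have : \det (subst_col (col' k V) i 0 + d *: subst_col (col' k E) i (moment n a0)) != 0.
  by move: i; near: d.
apply: contra_neq; set X := subst_col _ _ _ => X0.
transitivity (\det (subst_col (col' k V + d *: col' k E) i (d *: moment n a0))).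
  congr (\det _); apply/matrixP => r j; rewrite !mxE; case: eqP => //.
  by rewrite add0r.
by rewrite -cramer -scalemxAr mxE cramer X0 mulr0.
Unshelve. all: by end_near. Qed.

(** * Norms and Lebesgue numbers *)

Section column_norm.
Variable R : realType.

Lemma cV_norm_ge n (x : 'cV[R]_n) i : `|x i 0| <= `|x|.
Proof.
rewrite [leRHS]/Num.Def.normr /= mx_normrE.
exact: (le_bigmax _ (fun ij : 'I_n * 'I_1 => `|x ij.1 ij.2|) (i, 0)).
Qed.

Lemma cV_norm_le n (x : 'cV[R]_n) e : 0 <= e -> (forall i, `|x i 0| <= e) -> `|x| <= e.
Proof.
move=> e0 xe; rewrite /Num.Def.normr /= mx_normrE; apply: bigmax_le => // -[i j] _ /=.
by rewrite ord1; exact: xe.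
Qed.

Lemma cV_ball_compact n r : compact [set x : 'cV[R]_n | `|x| <= r].
Proof.
have -> : [set x : 'cV[R]_n | `|x| <= r] = trmx @` [set v : 'rV[R]_n | `|v| <= r].
  have tr_le (v : 'rV[R]_n) : `|v^T| <= `|v|.
    apply: cV_norm_le => // i; rewrite mxE [leRHS]/Num.Def.normr /= mx_normrE.
    exact: (le_bigmax _ (fun ij : 'I_1 * 'I_n => `|v ij.1 ij.2|) (0, i)).
  have le_tr (x : 'cV[R]_n) : `|x^T| <= `|x|.
    rewrite [leLHS]/Num.Def.normr /= mx_normrE; apply: bigmax_le => // -[i j] _ /=.
    by rewrite mxE ord1; exact: cV_norm_ge.
  apply/seteqP; split=> [x xr|_ [v vr] <-] /=; last exact: le_trans (tr_le v) vr.
  by exists x^T; [exact: le_trans (le_tr x) xr|exact: trmxK].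
apply: continuous_compact; last first.
  apply: bounded_closed_compact.
    by exists r; split => [|M rM v /= vr]; [exact: num_real|exact: le_trans vr (ltW rM)].
  have -> : [set v : 'rV[R]_n | `|v| <= r] = (fun v => `|v|) @^-1` [set t | t <= r] by [].
  by apply: closed_comp => [v _|]; [exact: norm_continuous|exact: closed_le].
apply: continuous_subspaceT => v U /nbhs_ballP[e /= e0 eU].
apply/nbhs_ballP; exists e => //= w [_ vw]; apply: eU; split=> // i j.
by rewrite !mxE; exact: vw.
Qed.

Lemma mulmx_norm_le n (A : 'M[R]_n) (x : 'cV[R]_n) :
  `|A *m x| <= (\sum_i \sum_j `|A i j|) * `|x|.
Proof.
apply: cV_norm_le => [|i]; first by rewrite mulr_ge0 // !sumr_ge0 // => i _; rewrite sumr_ge0.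
rewrite mxE; apply: le_trans (ler_norm_sum _ _ _) _.
rewrite mulr_suml [leRHS](bigD1 i) //= ler_wpDr //.
  by rewrite sumr_ge0 // => j _; rewrite mulr_ge0 // sumr_ge0.
rewrite mulr_suml ler_sum // => j _; rewrite normrM ler_wpM2l //; exact: cV_norm_ge.
Qed.

(** The sets [Z i e] depend on [e] so that a single number can serve both as a radius and as a
    margin or an inverse bound; monotonicity allows it to be decreased. *)
Lemma lebesgue_number (X : normedModType R) (K : set X) (I : Type) (Z : I -> R -> set X) :
  compact K -> (forall i e e', e' <= e -> Z i e `<=` Z i e') ->
  (forall x, K x -> exists2 e, 0 < e & exists i, forall y, `|x - y| < e -> Z i e y) ->
  exists2 e, 0 < e & forall x, K x -> exists i, forall y, `|x - y| < e -> Z i e y.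
Proof.
move=> /compact_near_coveringP Kc Zm loc.
pose P e x := exists i, forall y : X, `|x - y| < e -> Z i e y.
have : \forall e \near 0^'+, K `<=` P e.
  apply: Kc => x Kx; have [e e0 [i Zi]] := loc x Kx.
  have e20 : 0 < e / 2 by rewrite divr_gt0.
  exists (ball x (e / 2), [set e' : R | e' < e / 2]) => /=.
    by split; [exact: nbhsx_ballx|exact: nbhs_right_lt].
  move=> [x' e'] /= [xx' e'e]; exists i => y x'y.
  apply: (Zm i e); first by lra.
  apply: Zi; rewrite (le_lt_trans (ler_distD x' _ _)) // [e]splitr ltrD //.
    by rewrite -ball_normE in xx'.
  exact: lt_trans e'e.
move=> nP; near (0 : R)^'+ => e; exists e; last by near: e.
by near: e; exact: nbhs_right_gt.
Unshelve. all: by end_near. Qed.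

End column_norm.

(** * Signs of simplices and their stability under perturbation *)

(** The dependency [sum_facet_coef_row] has weights [V i k] of constant sign, so its coefficients
    cannot all have the same strict sign. *)
Lemma zero_side_half_space (R : realFieldType) n (V : 'M[R]_(n, n.+1)) i (c : bool) :
  (forall k, 0 < (-1) ^+ c * V i k) -> zero_side V = 0.
Proof.
move=> Vi; have := sum_facet_coef_row V i.
move/(congr1 ( *%R ((-1) ^+ c))); rewrite mulr0 mulr_sumr => /eqP sum0.
have pos0 (P : pred R) : (forall y, P y -> 0 < y) \/ (forall y, P y -> y < 0) ->
    [forall k, P (facet_coef V k)] = false.
  move=> Ppos; apply/negbTE/forallP => PV; move: sum0; apply/negP.
  case: Ppos => Pp; [rewrite gt_eqF // | rewrite lt_eqF //].
    rewrite (bigD1 ord0) //= ltr_wpDr //; last by rewrite mulrA mulr_gt0 // Pp.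
    by apply: sumr_ge0 => k _; rewrite mulrA ltW // mulr_gt0 // Pp.
  rewrite (bigD1 ord0) //= ltr_wnDr //; last by rewrite mulrA pmulr_rlt0 // Pp.
  by apply: sumr_le0 => k _; rewrite mulrA ltW // pmulr_rlt0 // Pp.
rewrite /zero_side (pos0 (fun y => 0 < y)) ?(pos0 (fun y => y < 0)) ?subrr //.
  by right.
by left.
Qed.

Lemma zero_side_sgr_ge0 (R : realFieldType) n (V : 'M[R]_(n, n.+1)) :
  0 <= Num.sg (\det (col_mx (const_mx 1) V : 'M[R]_(1 + n))) * zero_side V.
Proof.
rewrite -sum_facet_coef; under eq_bigr do rewrite mxE mul1r.
rewrite /zero_side; case: forallP => [Vp|_]; case: forallP => [Vn|_].
- by have := lt_trans (Vp ord0) (Vn ord0); rewrite ltxx.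
- by rewrite subr0 mulr1 sgr_ge0 sumr_ge0 // => k _; exact: ltW.
- by rewrite sub0r mulrN1 oppr_ge0 sgr_le0 sumr_le0 // => k _; exact: ltW.
- by rewrite subrr mulr0.
Qed.

Lemma zero_side_sgr (R : realFieldType) n (V : 'M[R]_(n, n.+1)) (s : R) :
  s != 0 -> (forall k, Num.sg (facet_coef V k) = s) -> zero_side V = s.
Proof.
move=> s0 Vs; have c0 k : (0 < facet_coef V k) = (0 < s) by rewrite -(Vs k) sgr_gt0.
have c1 k : (facet_coef V k < 0) = (s < 0) by rewrite -(Vs k) sgr_lt0.
have s1 : s = (0 < s)%R%:R - (s < 0)%R%:R.
  rewrite -(Vs ord0) sgr_gt0 sgr_lt0; case: sgrP => // _; rewrite ?subrr //=.
    by rewrite subr0.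
  by rewrite sub0r.
rewrite [RHS]s1 /zero_side; congr ((nat_of_bool _)%:R - (nat_of_bool _)%:R)%R.
  by apply/forallP/idP => [/(_ ord0)|s_gt0 k]; rewrite c0.
by apply/forallP/idP => [/(_ ord0)|s_lt0 k]; rewrite c1.
Qed.

Section kuhn_simplex.
Variables (R : realType) (n N : nat).
Implicit Types (f : {ffun 'I_n.+1 -> 'I_N.+2} -> 'cV[R]_n.+1).

Definition simplex f x (tau : 'S_n.+1) : 'M[R]_(n.+1, n.+2) :=
  \matrix_(i, k) f (kuhn_vertex x tau k) i 0.

(** Distinct lattice points get distinct natural parameters, all different from the parameter -1
    later given to the ray. *)
Definition perturb f (d : R) := fun t => f t + d *: moment n.+1 (enum_rank t)%:R.

Lemma sum_zero_side f u : (forall x tau, generic u (simplex f x tau)) ->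
  \sum_x \sum_(tau : 'S_n.+1) (-1) ^+ tau * zero_side (simplex f x tau) = 0.
Proof.
move=> fg; rewrite -[RHS](sum_kuhn_boundary
   (fun F : {ffun 'I_n.+1 -> _} => crossing u (\matrix_(i, j) f (F j) i 0))).
apply: eq_bigr => x _; apply: eq_bigr => tau _; congr (_ * _).
rewrite -(sum_facet_crossing (u := u)); first last.
- by move=> k i; have [_ h] := fg x tau k; exact: h.
- by move=> k; have [] := fg x tau k.
apply: eq_bigr => k _; congr (_ * crossing _ _).
by apply/matrixP => i j; rewrite !mxE ffunE.
Qed.

Lemma kuhn_vertex_inj x (tau : 'S_n.+1) :
  injective (fun k : 'I_n.+2 => kuhn_vertex x tau k : {ffun 'I_n.+1 -> 'I_N.+2}).
Proof.
have neq (j k : 'I_n.+2) : (j < k)%N -> kuhn_vertex x tau j <> kuhn_vertex x tau k.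
  move=> jk; have jn : (j < n.+1)%N by rewrite (leq_trans jk) // -ltnS.
  move=> /ffunP/(_ (tau^-1 (Ordinal jn))%g); rewrite !ffunE permKV /= ltnn jk.
  by move=> /addrI/eqP; rewrite eq_sym oner_eq0.
move=> j k jk; apply: val_inj; case: (ltngtP j k) => // /neq; rewrite jk //.
Qed.

Lemma simplex_perturb f d x tau : simplex (perturb f d) x tau = simplex f x tau +
  d *: \matrix_(i, k) moment n.+1 (enum_rank (kuhn_vertex x tau k))%:R i 0.
Proof. by apply/matrixP => i k; rewrite !mxE. Qed.

Lemma generic_perturb_near f : \forall d \near 0^'+,
  forall x tau, generic (moment n.+1 (-1)) (simplex (perturb f d) x tau).
Proof.
apply: filter_forall => x; apply: filter_forall => tau.
under eq_near do rewrite simplex_perturb.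
apply: generic_near => [j k /eqP|k].
  by rewrite eqr_nat => /eqP/val_inj/enum_rank_inj/kuhn_vertex_inj.
by rewrite gt_eqF // (lt_le_trans (ltrN10 _)) // ler0n.
Qed.

Lemma sgr_facet_perturb_near f : \forall d \near 0^'+, forall x tau k,
  facet_coef (simplex f x tau) k != 0 ->
  Num.sg (facet_coef (simplex (perturb f d) x tau) k) =
  Num.sg (facet_coef (simplex f x tau) k).
Proof.
apply: filter_forall => x; apply: filter_forall => tau; apply: filter_forall => k.
have [->|F0] := eqVneq (facet_coef (simplex f x tau) k) 0.
  by exact: nearW.
have D0 : \det (col' k (simplex f x tau)) != 0.
  by move: F0; rewrite /facet_coef mulf_eq0 negb_or => /andP[].
apply: filterS (sgr_det_addZ_near
  (col' k (\matrix_(i, k) moment n.+1 (enum_rank (kuhn_vertex x tau k))%:R i 0)) D0).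
move=> d hd _; rewrite /facet_coef !sgrM -hd simplex_perturb; congr (_ * Num.sg (\det _)).
by apply/matrixP => i j; rewrite !mxE.
Qed.

Lemma sgr_det_perturb_near f : \forall d \near 0^'+, forall x tau,
  \det (col_mx (const_mx 1) (simplex f x tau) : 'M[R]_(1 + n.+1)) != 0 ->
  Num.sg (\det (col_mx (const_mx 1) (simplex (perturb f d) x tau) : 'M[R]_(1 + n.+1))) =
  Num.sg (\det (col_mx (const_mx 1) (simplex f x tau) : 'M[R]_(1 + n.+1))).
Proof.
apply: filter_forall => x; apply: filter_forall => tau.
set D := \det (col_mx (const_mx 1) (simplex f x tau) : 'M[R]_(1 + n.+1)).
have [->|D0] := eqVneq D 0; first by exact: nearW.
apply: filterS (sgr_det_addZ_near (col_mx (0 : 'M[R]_(1, n.+2))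
  (\matrix_(i, k) moment n.+1 (enum_rank (kuhn_vertex x tau k))%:R i 0) : 'M[R]_(1 + n.+1)) D0).
move=> d hd _; rewrite -hd simplex_perturb; congr (Num.sg (\det _)).
by rewrite scale_col_mx add_col_mx scaler0 addr0.
Qed.

Lemma perturb_small_near f (e : R) : 0 < e -> \forall d \near 0^'+,
  forall t i, `|perturb f d t i 0 - f t i 0| < e.
Proof.
move=> e0; apply: filter_forall => t; apply: filter_forall => i.
have m0 : 0 <= `|moment n.+1 (enum_rank t)%:R i 0 : R| by [].
near=> d; rewrite !mxE addrAC subrr add0r normrM.
have d0 : 0 < d by near: d; exact: nbhs_right_gt.
rewrite gtr0_norm //.
have : d * (`|moment n.+1 (enum_rank t)%:R i 0 : R| + 1) < e.
  rewrite -ltr_pdivlMr ?ltr_wpDl //; near: d; apply: nbhs_right_lt.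
  by rewrite divr_gt0 // ltr_wpDl.
by rewrite mxE; apply: le_lt_trans; rewrite ler_pM2l // lerDl.
Unshelve. all: by end_near. Qed.

End kuhn_simplex.

(** * Zeros of coherently oriented maps *)

Lemma continuous_dist_lt (R : realType) m n (F : 'cV[R]_m -> 'cV[R]_n) x e :
  continuous F -> 0 < e ->
  exists2 d, 0 < d & forall y, `|x - y| < d -> `|F x - F y| < e.
Proof.
move=> cF e0; have /nbhs_ballP[d /= d0 dF] := cF x _ (nbhsx_ballx (F x) e e0).
exists d => // y xy; have : ball x d y by rewrite -ball_normE.
by move=> /dF; rewrite -ball_normE.
Qed.

(** Where [F] is nonzero, continuity keeps one coordinate away from 0; where it vanishes, it is
    locally affine by hypothesis. Compactness makes the scale uniform. *)
Lemma uniform_half_space_or_affine (R : realType) n k (F : 'cV[R]_n -> 'cV[R]_n)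
    (A : 'I_k -> 'M[R]_n) (b : 'I_k -> 'cV[R]_n) (K : set 'cV[R]_n) :
  compact K -> continuous F ->
  (forall x, F x = 0 -> exists i, \forall y \near x, F y = A i *m y + b i) ->
  exists2 e, 0 < e & forall x, K x ->
    (exists i c, forall y, `|x - y| < e -> e < (-1) ^+ (c : bool) * F y i 0) \/
    (exists i, forall y, `|x - y| < e -> F y = A i *m y + b i).
Proof.
move=> Kc cF F0.
pose Z (z : ('I_n * bool) + 'I_k) e := match z with
  | inl (i, c) => [set y | e < (-1) ^+ c * F y i 0]
  | inr i => [set y | F y = A i *m y + b i] end.
have [|x Kx|e e0 He] := lebesgue_number (Z := Z) Kc.
- by move=> [[i c]|i] e e' ee' y //=; exact: le_lt_trans.
- have [Fx|/eqP Fx] := pselect (F x = 0).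
    have [i /nbhs_ballP[e /= e0 He]] := F0 x Fx; exists e => //; exists (inr i) => y xy.
    by apply: He; rewrite -ball_normE.
  have [i Fi] : exists i, F x i 0 != 0.
    apply/existsP; apply: contra_neqT Fx => /existsPn h.
    by apply/colP => i; rewrite mxE; apply/eqP; have := h i; rewrite negbK.
  have v0 : 0 < `|F x i 0| / 2 by rewrite divr_gt0 // normr_gt0.
  have [d d0 Hd] := continuous_dist_lt x cF v0.
  exists (Num.min d (`|F x i 0| / 2)); first by rewrite lt_min d0.
  exists (inl (i, F x i 0 < 0)) => y; rewrite lt_min => /andP[/Hd xy _] /=.
  have := le_lt_trans (cV_norm_ge (F x - F y) i) xy; rewrite !mxE => xyi.
  rewrite gt_min; apply/orP; right; move: xyi; rewrite ltr_distlC.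
  case: (ltrP (F x i 0) 0) => Fs; rewrite /= ?expr1 ?expr0.
    by rewrite ltr0_norm // => /andP[]; lra.
  by rewrite ger0_norm // => /andP[]; lra.
- exists e => // x Kx; have [[[i c]|i] Hi] := He x Kx; [left|right]; last by exists i.
  by exists i, c.
Qed.

Lemma perturb_half_space (R : realType) n N (f : {ffun 'I_n.+1 -> 'I_N.+2} -> 'cV[R]_n.+1)
    d e x tau i (c : bool) :
  (forall t i, `|perturb f d t i 0 - f t i 0| < e) ->
  (forall k : 'I_n.+2, e < (-1) ^+ c * f (kuhn_vertex x tau k) i 0) ->
  zero_side (simplex (perturb f d) x tau) = 0.
Proof.
move=> fe fc; apply: (@zero_side_half_space _ _ _ i c) => k; rewrite mxE.
have := fe (kuhn_vertex x tau k) i; have := fc k.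
rewrite ltr_distlC; case: c {fc}; rewrite /= ?expr1 ?expr0 => h1 /andP[h2 h3]; lra.
Qed.

(** * Geometric grids and their boundary layers *)

Definition grid_point (R : realType) n N (e : R) (o : 'cV[R]_n) (t : {ffun 'I_n -> 'I_N}) :
  'cV[R]_n := \col_i (e * (t i : nat)%:R) + o.

Lemma grid_point_vertex (R : realType) n N (e : R) (o : 'cV[R]_n)
    (t : {ffun 'I_n -> 'I_N.+2}) tau (k : 'I_n.+1) :
  (forall i, t i != ord_max) ->
  grid_point e o (kuhn_vertex t tau k) = grid_point e o t + e *: col k (kuhn_mx R tau).
Proof.
move=> tN; rewrite /grid_point [RHS]addrAC; congr (_ + _).
apply/colP => i; rewrite !mxE !ffunE -mulrDr -natrD; congr (_ * _%:R).
have tiN : (t i < N.+1)%N.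
  by rewrite ltn_neqAle -ltnS ltn_ord andbT; have := tN i; rewrite -val_eqE.
by case: (_ < _)%N; rewrite /= ?addn0 ?addn1 modn_small // ltnS ltnW.
Qed.

(** The matrix with the row of ones sends the constant vector [n.+1%:R^-1] to the first basis
    vector; applying its adjugate identifies the cofactors of that row. *)
Lemma facet_coef_barycenter (R : fieldType) n (V : 'M[R]_(n, n.+1)) k :
  n.+1%:R != 0 :> R -> (forall i, \sum_k V i k = 0) ->
  facet_coef V k = \det (col_mx (const_mx 1) V : 'M[R]_(1 + n)) / n.+1%:R.
Proof.
move=> n0 V0; set M : 'M[R]_(1 + n) := col_mx _ V.
rewrite -(facet_coef_cofactor (const_mx 1)) -/M.
have Ml : M *m const_mx n.+1%:R^-1 = delta_mx 0 0 :> 'cV[R]_(1 + n).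
  apply/colP => i; rewrite mxE; case: (split_ordP i) => j ->.
    under eq_bigr do rewrite col_mxEu !mxE mul1r.
    by rewrite sumr_const card_ord -[LHS]mulr_natr mulVf // !mxE ord1 eqxx.
  under eq_bigr do rewrite col_mxEd [const_mx _ _ _]mxE.
  by rewrite -mulr_suml V0 mul0r !mxE -val_eqE.
have := congr1 (fun X : 'cV_(1 + n) => (\adj M *m X) k 0) Ml.
rewrite mulmxA mul_adj_mx mul_scalar_mx !mxE => ->.
rewrite (bigD1 0) //= big1 ?addr0 => [|j j0]; first by rewrite !mxE eqxx mulr1.
by rewrite !mxE (negbTE j0) mulr0.
Qed.

Section grid.
Variables (R : realType) (n M : nat) (e : R).
Hypothesis e0 : 0 < e.

(* With this origin, [0] is the barycenter of the simplex spanned by the grid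
   points [kuhn_vertex t 1 k], where all coordinates of [t] are [M]. *)
Definition grid_bary (j : 'I_n) : R := (\sum_(k < n.+1) (j < k)%:R) / n.+1%:R.

Definition grid_origin : 'cV[R]_n := \col_i - (e * (M%:R + grid_bary i)).

Local Notation pos := (@grid_point R n (M.*2).+2 e grid_origin).

Let natr_double1 : (M.*2).+1%:R = 2 * M%:R + 1 :> R.
Proof. by rewrite -natr1 -muln2 natrM mulrC. Qed.

Lemma grid_bary_itv j : 0 <= grid_bary j <= 1.
Proof.
rewrite divr_ge0 //=; last by rewrite sumr_ge0.
rewrite ler_pdivrMr ?ltr0n // mul1r -[leRHS]mulr1n -natr_sum ler_nat.
have : (\sum_(k < n.+1) (j < k) <= \sum_(k < n.+1) 1)%N.
  by apply: leq_sum => k _; exact: leq_b1.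
by rewrite sum1_card card_ord.
Qed.

Lemma grid_pointE t i : pos t i 0 = e * ((t i : nat)%:R - M%:R - grid_bary i).
Proof. by rewrite !mxE; ring. Qed.

Lemma grid_point_norm_le t : `|pos t| <= e * M.+1%:R.
Proof.
apply: cV_norm_le => [|i]; first by rewrite mulr_ge0 // ltW.
rewrite grid_pointE normrM gtr0_norm // ler_pM2l // ler_norml.
have /andP[b0 b1] := grid_bary_itv i.
have : (t i : nat)%:R <= (M.*2).+1%:R :> R by rewrite ler_nat -ltnS ltn_ord.
have : 0 <= (t i : nat)%:R :> R by [].
rewrite natr_double1 -natr1; set x := (t i)%:R; lra.
Qed.

Lemma grid_point_norm_ge (t : {ffun 'I_n -> 'I_(M.*2).+2}) i :
  (t i == ord0) || (t i == ord_max) ->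
  e * M%:R <= `|pos t|.
Proof.
move=> ti; apply: le_trans (cV_norm_ge _ i).
rewrite grid_pointE normrM gtr0_norm // ler_pM2l //.
have /andP[b0 b1] := grid_bary_itv i.
case/orP: ti => /eqP ->; rewrite ler_normr /=; apply/orP; [right|left].
  lra.
rewrite natr_double1; lra.
Qed.

Lemma norm_col_kuhn_mx tau (k : 'I_n.+1) : `|e *: col k (kuhn_mx R tau)| <= e.
Proof.
apply: cV_norm_le => [|i]; first exact: ltW.
rewrite !mxE normrM gtr0_norm //.
by case: (_ < _)%N; rewrite ?normr1 ?normr0 ?mulr0 ?mulr1 // ltW.
Qed.

End grid.

Lemma kuhn_vertex_wrap n N (t : {ffun 'I_n -> 'I_N.+2}) tau k i :
  t i = ord_max ->
  (kuhn_vertex t tau k i == ord0) || (kuhn_vertex t tau k i == ord_max).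
Proof.
move=> ti; rewrite !ffunE ti; case: (_ < _)%N; last by rewrite addr0 eqxx orbT.
by rewrite -!val_eqE /= addn1 modnn eqxx.
Qed.

Section coherent_zero.
Variables (R : realType) (n k : nat) (G H : 'cV[R]_n.+1 -> 'cV[R]_n.+1).
Variables (A : 'I_k -> 'M[R]_n.+1) (b : 'I_k -> 'cV[R]_n.+1) (s r : R).
Hypotheses (cG : continuous G) (cH : continuous H).
Hypothesis GH : forall x, r <= `|x| -> G x = H x.
Hypothesis G0 : G 0 = 0.
Hypothesis G_affine : forall x, G x = 0 -> exists i, \forall y \near x, G y = A i *m y + b i.
Hypotheses (s0 : s != 0) (sA : forall i, Num.sg (\det (A i)) = s).

(** If [H] had no zero, the difference of the vanishing counts of [G] and [H], multiplied by [s],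
    would be a sum of nonnegative terms, one of them equal to 1. *)
Lemma coherent_zero : exists x, H x = 0.
Proof.
apply/not_existsP => H0.
pose B : set 'cV[R]_n.+1 := [set x | `|x| <= `|r| + 2].
have cB : compact B := @cV_ball_compact _ _ _.
have [eG eG0 HG] := uniform_half_space_or_affine cB cG G_affine.
(* The empty family of affine pieces leaves only the half space alternative for [H]. *)
have H_affine x : H x = 0 -> exists i : 'I_0, \forall y \near x, H y = 0 *m y + 0.
  by move=> /(H0 x).
have [eH eH0 HH] := uniform_half_space_or_affine cB cH H_affine.
pose e := Num.min (Num.min eG eH / 2) 1.
have e0 : 0 < e by rewrite !lt_min divr_gt0 ?lt_min ?eG0 ?eH0 //= ltr01.
have eEE : e <= Num.min eG eH / 2 /\ e <= 1 by rewrite !ge_min !lexx orbT.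
have [eE e1] := eEE.
have [eltG eltH] : e < eG /\ e < eH.
  have m0 : 0 < Num.min eG eH by rewrite lt_min eG0.
  have eM : e < Num.min eG eH by lra.
  by move: eM; rewrite lt_min => /andP.
(* [e * M] reaches [|r|], and [e * M.+1] exceeds [|r|] by at most [2 * e <= 2]; hence the radius of
   [B]. *)
pose M := (Num.truncn (`|r| / e)).+1.
have rM : `|r| <= e * M%:R.
  by rewrite mulrC -ler_pdivrMr // ltW // truncnS_gt.
have Mr : e * M.+1%:R <= `|r| + 2.
  have : (Num.truncn (`|r| / e))%:R <= `|r| / e.
    by rewrite truncn_le // divr_ge0 // ltW.
  rewrite ler_pdivlMr // mulrC => h; rewrite -!natr1 !mulrDr !mulr1; lra.
pose o := @grid_origin R n.+1 M e; pose pos := @grid_point R n.+1 (M.*2).+2 e o.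
have posB t : B (pos t) by rewrite /B /= (le_trans (grid_point_norm_le e0 _)).
have vtx_close (t : {ffun 'I_n.+1 -> 'I_(M.*2).+2}) (tau : 'S_n.+1) (j : 'I_n.+2) :
    (forall i, t i != ord_max) ->
    `|pos t - pos (kuhn_vertex t tau j)| <= e.
  move=> tN; rewrite /pos grid_point_vertex // opprD addrA subrr add0r normrN.
  exact: norm_col_kuhn_mx.
pose g := G \o pos; pose h := H \o pos; pose u := moment n.+1 (-1 : R).
(* All vertices of a wrapping simplex lie on the outer layers of the grid, at norm at least [r]. *)
have gh_wrap (t : {ffun 'I_n.+1 -> 'I_(M.*2).+2}) (tau : 'S_n.+1) (j : 'I_n.+2) i :
    t i = ord_max ->
    g (kuhn_vertex t tau j) = h (kuhn_vertex t tau j).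
  move=> ti; apply: GH; rewrite (le_trans (ler_norm r)) // (le_trans rM) //.
  apply: (grid_point_norm_ge e0 (i := i)); exact: kuhn_vertex_wrap.
have detg (t : {ffun 'I_n.+1 -> 'I_(M.*2).+2}) (tau : 'S_n.+1) i :
    (forall i, t i != ord_max) ->
    (forall y, `|pos t - y| < eG -> G y = A i *m y + b i) ->
    Num.sg (\det (col_mx (const_mx 1) (simplex g t tau) : 'M[R]_(1 + n.+1)))
    = s * (-1) ^+ tau.
  move=> tN Gi; rewrite (@det_affine_kuhn_mx _ _ tau (A i) (pos t) (b i) e) => [|j].
    by rewrite !sgrM !sgrX (gtr0_sg e0) expr1n mulr1 sA sgrN1.
  have -> : col j (simplex g t tau) = g (kuhn_vertex t tau j).
    by apply/colP => a; rewrite !mxE.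
  rewrite /g /= -[pos t + _]grid_point_vertex // Gi //.
  exact: le_lt_trans (vtx_close _ _ _ _) _.
(* The zero at the origin provides a piece, so [s] is the sign of a determinant and its square is
   1. *)
have [i0 _] := G_affine G0.
have sq1 : s * s = 1.
  by rewrite -(sA i0) -expr2 sqr_sg -sgr_eq0 sA s0.
near (0 : R)^'+ => d.
have gen_g : forall x tau, generic u (simplex (perturb g d) x tau).
  by near: d; exact: generic_perturb_near.
have gen_h : forall x tau, generic u (simplex (perturb h d) x tau).
  by near: d; exact: generic_perturb_near.
have small_g : forall t i, `|perturb g d t i 0 - g t i 0| < eG.
  by near: d; exact: perturb_small_near.
have small_h : forall t i, `|perturb h d t i 0 - h t i 0| < eH.
  by near: d; exact: perturb_small_near.
pose zg (t : {ffun 'I_n.+1 -> 'I_(M.*2).+2}) (tau : 'S_n.+1) :=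
  zero_side (simplex (perturb g d) t tau).
pose zh (t : {ffun 'I_n.+1 -> 'I_(M.*2).+2}) (tau : 'S_n.+1) :=
  zero_side (simplex (perturb h d) t tau).
have zh0 (t : {ffun 'I_n.+1 -> 'I_(M.*2).+2}) (tau : 'S_n.+1) :
    (forall i, t i != ord_max) -> zh t tau = 0.
  move=> tN; have [[i [c Hi]]|[[] //]] := HH _ (posB t).
  apply: (perturb_half_space (i := i) (c := c) small_h) => j; apply: Hi.
  exact: le_lt_trans (vtx_close _ _ _ tN) eltH.
have zg_ge0 (t : {ffun 'I_n.+1 -> 'I_(M.*2).+2}) (tau : 'S_n.+1) :
    (forall i, t i != ord_max) -> 0 <= s * ((-1) ^+ tau * zg t tau).
  move=> tN; have [[i [c Hi]]|[i Gi]] := HG _ (posB t).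
    rewrite /zg (perturb_half_space (i := i) (c := c) small_g) ?mulr0 // => j; apply: Hi.
    exact: le_lt_trans (vtx_close _ _ _ tN) eltG.
  have sgD := detg _ tau _ tN Gi.
  rewrite mulrA -sgD.
  have D0 : \det (col_mx (const_mx 1) (simplex g t tau) : 'M[R]_(1 + n.+1)) != 0.
    by rewrite -sgr_eq0 sgD mulf_neq0 // signr_eq0.
  have <- : Num.sg (\det (col_mx (const_mx 1) (simplex (perturb g d) t tau) :
    'M[R]_(1 + n.+1))) =
    Num.sg (\det (col_mx (const_mx 1) (simplex g t tau) : 'M[R]_(1 + n.+1))).
    by move: D0; move: t tau {tN Gi sgD}; near: d; exact: sgr_det_perturb_near.
  exact: zero_side_sgr_ge0.
have term_ge0 (t : {ffun 'I_n.+1 -> 'I_(M.*2).+2}) (tau : 'S_n.+1) :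
    0 <= s * ((-1) ^+ tau * (zg t tau - zh t tau)).
  have [[i ti]|tN] := pselect (exists i, t i = ord_max).
    have gh : simplex g t tau = simplex h t tau.
      by apply/matrixP => a j; rewrite [LHS]mxE [RHS]mxE (gh_wrap _ _ _ _ ti).
    by rewrite /zg /zh !simplex_perturb gh subrr !mulr0.
  have {}tN i : t i != ord_max by apply: contra_notN tN => /eqP ti; exists i.
  by rewrite zh0 // subr0 zg_ge0.
pose t0 : {ffun 'I_n.+1 -> 'I_(M.*2).+2} := [ffun=> inord M].
have t0M i : t0 i = M :> nat.
  by rewrite ffunE inordK // ltnS -addnn ltnW // ltnS leq_addr.
have t0N i : t0 i != ord_max.
  by rewrite -val_eqE /= t0M -addnn ltn_eqF // ltnS leq_addr.
have pos_t0 : pos t0 = \col_i - (e * grid_bary R i).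
  by apply/colP => i; rewrite grid_pointE t0M !mxE subrr sub0r mulrN.
have pos_t0_small : `|pos t0 - 0| < eG.
  rewrite subr0; apply: le_lt_trans eltG; apply: cV_norm_le => [|i]; first exact: ltW.
  have /andP[b0 b1] := grid_bary_itv R i.
  by rewrite pos_t0 mxE normrN normrM gtr0_norm // ger0_norm // ler_piMr // ltW.
(* Near this simplex [G] is linear, so the image simplex has barycenter 0 and its facet coefficients
   all have the strict sign [s], which a small perturbation preserves. *)
have zg_t0 : zg t0 1%g = s.
  have [[i [c Hi]]|[i Gi]] := HG _ (posB t0).
    by have := Hi 0 pos_t0_small; rewrite G0 mxE mulr0 ltNge ltW.
  have bi : b i = 0 by have := Gi 0 pos_t0_small; rewrite G0 mulmx0 add0r.
  have sgD := detg _ 1%g _ t0N Gi; rewrite odd_perm1 mulr1 in sgD.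
  have facetE j : Num.sg (facet_coef (simplex g t0 1%g) j) = s.
    rewrite facet_coef_barycenter ?pnatr_eq0 // => [|a].
      by rewrite sgrM sgD gtr0_sg ?mulr1 // invr_gt0 ltr0n.
    transitivity ((A i *m (\sum_(l < n.+2) pos (kuhn_vertex t0 1 l))) a 0).
      rewrite mulmx_sumr summxE; apply: eq_bigr => l _; rewrite mxE /g /= Gi ?bi ?addr0 //.
      exact: le_lt_trans (vtx_close _ _ _ t0N) eltG.
    rewrite (_ : \sum_(l < n.+2) _ = 0) ?mulmx0 ?mxE //.
    apply/colP => c; rewrite summxE mxE.
    have vE (l : 'I_n.+2) : pos (kuhn_vertex t0 1%g l) c 0 =
        - (e * grid_bary R c) + e * (c < l)%:R.
      by rewrite /pos grid_point_vertex // -/(pos t0) pos_t0 !mxE perm1.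
    under eq_bigr do rewrite vE.
    rewrite big_split /= sumr_const card_ord -mulr_sumr -[X in X + _]mulr_natr.
    by rewrite mulNr -mulrA divfK ?pnatr_eq0 // addNr.
  apply: (zero_side_sgr s0) => j; rewrite -[RHS](facetE j).
  have F0 : facet_coef (simplex g t0 1%g) j != 0 by rewrite -sgr_eq0 facetE.
  have sf : forall x tau k, facet_coef (simplex g x tau) k != 0 ->
    Num.sg (facet_coef (simplex (perturb g d) x tau) k) =
    Num.sg (facet_coef (simplex g x tau) k).
    by near: d; exact: sgr_facet_perturb_near.
  exact: sf.
have sum0 : \sum_t \sum_(tau : 'S_n.+1) s * ((-1) ^+ tau * (zg t tau - zh t tau)) = 0.
  transitivity (s * (\sum_t \sum_(tau : 'S_n.+1) (-1) ^+ tau * zg t tau -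
                     \sum_t \sum_(tau : 'S_n.+1) (-1) ^+ tau * zh t tau)).
    rewrite -sumrB mulr_sumr; apply: eq_bigr => t _.
    rewrite -sumrB mulr_sumr; apply: eq_bigr => tau _.
    by rewrite mulrBr.
  by rewrite (sum_zero_side gen_g) (sum_zero_side gen_h) subrr mulr0.
move: sum0; apply/eqP; rewrite gt_eqF // (bigD1 t0) //= ltr_wpDr //.
  by apply: sumr_ge0 => t _; apply: sumr_ge0.
rewrite (bigD1 1%g) //= ltr_wpDr //; first by apply: sumr_ge0.
by rewrite zh0 // zg_t0 odd_perm1 subr0 expr0 mul1r sq1.
Unshelve. all: by end_near. Qed.

End coherent_zero.

(** * Surjectivity of perturbed coherently oriented maps *)

(** On the curve [t, t^2, ..., t^n] each condition becomes a polynomial vector in [t] whose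
    coefficients are the entries of [B j] and [d j]; small [t > 0] avoids its zeros. *)
Lemma generic_point (R : realType) n (J : finType) (P : pred J)
    (B : J -> 'M[R]_n) (d : J -> 'cV[R]_n) :
  (forall j, P j -> B j = 0 -> d j <> 0) ->
  exists x, forall j, P j -> B j *m x + d j <> 0.
Proof.
move=> Bd.
pose p j r : {poly R} :=
  (d j r 0)%:P + 'X * \poly_(i < n) (if insub i is Some i' then B j r i' else 0).
have p0 j : P j -> exists r, p j r != 0.
  move=> Pj; apply/existsP; apply: contraT => /existsPn pj; exfalso.
  have {}pj r : p j r = 0 by apply/eqP; have := pj r; rewrite negbK.
  apply: (Bd j Pj).
    apply/matrixP => r i; have := congr1 (fun q : {poly R} => q`_i.+1) (pj r).
    by rewrite coefD coefC coefXM /= add0r coef_poly ltn_ord valK coef0 mxE.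
  apply/colP => r; have := congr1 (fun q : {poly R} => q`_0) (pj r).
  by rewrite coefD coefC eqxx coefXM eqxx addr0 coef0 mxE.
have near_p : \forall t \near (0 : R)^'+, forall j, P j ->
    B j *m (\col_i t ^+ i.+1) + d j <> 0.
  apply: filter_forall => j; have [Pj|nPj] := boolP (P j); last exact: nearW.
  have [r pr] := p0 j Pj; apply: filterS (poly_near_neq0 pr) => t pt _.
  move=> Bd0; have /colP/(_ r) := Bd0; rewrite !mxE => Bt0; move: pt; apply/negP; rewrite negbK.
  rewrite -[X in _ == X]Bt0; apply/eqP; rewrite [RHS]addrC hornerD hornerC; congr (_ + _).
  rewrite hornerM hornerX horner_poly mulr_sumr; apply: eq_bigr => i _.
  by rewrite valK mxE exprS mulrCA.
have [t Ht] := filter_ex near_p.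
by exists (\col_i t ^+ i.+1).
Qed.

Lemma lipschitz_continuous (R : realType) m n (F : 'cV[R]_m -> 'cV[R]_n) c :
  (forall x y, `|F x - F y| <= c * `|x - y|) -> continuous F.
Proof.
move=> Fc x U /nbhs_ballP[e /= e0 eU]; apply/nbhs_ballP.
have c0 : 0 < `|c| + 1 by rewrite ltr_wpDl.
exists (e / (`|c| + 1)); first by rewrite /= divr_gt0.
move=> y; rewrite -ball_normE /= => xy; apply: eU; rewrite -ball_normE /=.
apply: le_lt_trans (Fc x y) _; rewrite ltr_pdivlMr // mulrC in xy.
by apply: le_lt_trans xy; rewrite ler_wpM2r // (le_trans (ler_norm c)) // lerDl.
Qed.

Lemma affine_continuous (R : realType) n (A : 'M[R]_n) (b : 'cV[R]_n) :
  continuous (fun x => A *m x + b).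
Proof.
apply: (@lipschitz_continuous _ _ _ _ (\sum_i \sum_j `|A i j|)) => x y.
by rewrite opprD addrACA subrr addr0 -mulmxBr; exact: mulmx_norm_le.
Qed.

(* Stated for abstract normed modules: on matrices, unification unfolds the
   neighbourhood filters and the filter instances are no longer found. *)
Lemma continuous_addl (R : realType) (V : normedModType R) (x0 : V) :
  continuous (fun x => x0 + x).
Proof. by move=> x; apply: cvgD; [exact: cvg_cst|exact: cvg_id]. Qed.

Section continuity.
Variables (R : realType) (U V : normedModType R).
Implicit Types F G : U -> V.

Lemma continuous_sub F G :
  continuous F -> continuous G -> continuous (fun x => F x - G x).
Proof. by move=> cF cG x; apply: cvgB; [exact: cF|exact: cG]. Qed.

Lemma continuous_translate F x0 z :
  continuous F -> continuous (fun x => F (x0 + x) - z).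
Proof.
move=> cF x; apply: cvgB; last exact: cvg_cst.
by apply: continuous_comp; [exact: continuous_addl|exact: cF].
Qed.

Lemma continuous_cutoff (r : R) :
  continuous (fun x : U => Num.max 0 (Num.min 1 (2 - r^-1 * `|x|))).
Proof.
move=> x; apply: (@continuous_max R U (fun=> 0) (fun x => Num.min 1 (2 - r^-1 * `|x|)) x);
  first exact: cst_continuous.
apply: (@continuous_min R U (fun=> 1) (fun x => 2 - r^-1 * `|x|) x); first exact: cst_continuous.
apply: cvgB; first exact: cvg_cst.
by apply: cvgM; [exact: cvg_cst|exact: norm_continuous].
Qed.

Lemma continuous_blend F G (chi : U -> R) :
  continuous F -> continuous G -> continuous chi ->
  continuous (fun x => F x + chi x *: (G x - F x)).
Proof.
move=> cF cG cchi x; apply: cvgD; first exact: cF.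
by apply: cvgZ; [exact: cchi|apply: cvgB; [exact: cG|exact: cF]].
Qed.

End continuity.

(** [G x0] is a regular value: at each of its preimages all active affine pieces coincide. Choosing
    [x0] rather than the value ensures that the value is attained. *)
Lemma composed_of_regular_value (R : realType) n k (G : 'cV[R]_n -> 'cV[R]_n)
    (A : 'I_k -> 'M[R]_n) (b : 'I_k -> 'cV[R]_n) :
  continuous G -> composed_of G A b -> (forall i, A i \in unitmx) ->
  exists x0, forall x, G x = G x0 -> exists i, \forall y \near x, G y = A i *m y + b i.
Proof.
move=> cG GA Au.
(* For [t = (l, i, j)], if piece [l] at [x0] and piece [i] at [x] give the same value, the
   difference of pieces [j] and [i] at [x] is affine in [x0]. It vanishes identically only if these
   pieces are equal, as the [A l] are invertible. *)
pose P (t : 'I_k * 'I_k * 'I_k) := (A t.1.2, b t.1.2) != (A t.2, b t.2).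
pose M (t : 'I_k * 'I_k * 'I_k) := (A t.2 - A t.1.2) *m invmx (A t.1.2).
have [t Pt B0|x0 Hx0] := @generic_point R n _ P (fun t => M t *m A t.1.1)
    (fun t => M t *m (b t.1.1 - b t.1.2) + (b t.2 - b t.1.2)).
  have M0 : M t = 0.
    by rewrite -[M t](mulmxK (Au t.1.1)) B0 mul0mx.
  rewrite M0 mul0mx add0r => /subr0_eq bE.
  move: Pt; rewrite /P bE; apply/negP; rewrite negbK; apply/eqP; congr (_, _).
  by apply/esym/subr0_eq; rewrite -[LHS](mulmxKV (Au t.1.2)) -/(M t) M0 mul0mx.
exists x0 => x GxE; have [l Gx0] := GA x0; have [i Gx] := GA x; exists i.
have xE : x = invmx (A i) *m (A l *m x0 + b l - b i).
  by rewrite -Gx0 -GxE Gx addrK mulKmx.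
have near_j j : \forall y \near x, (A i, b i) = (A j, b j) \/ G y <> A j *m y + b j.
  have [ij|ij] := eqVneq (A i, b i) (A j, b j).
    by apply: (filterS _ (@filterT _ (nbhs x) _)) => y _; left.
  have Gj : G x - (A j *m x + b j) != 0.
    have := Hx0 (l, i, j) ij; rewrite /M /= => h; apply/eqP => hx; apply: h.
    transitivity ((A j - A i) *m x + (b j - b i)).
      by rewrite xE !mulmxDr !mulmxA !addrA.
    by rewrite mulmxBl addrACA -opprD -Gx -opprB hx oppr0.
  have cj := @continuous_sub R 'cV[R]_n 'cV[R]_n G _ cG (@affine_continuous R n (A j) (b j)).
  have g0 : 0 < `|G x - (A j *m x + b j)| by rewrite normr_gt0.
  have [e e0 He] := continuous_dist_lt x cj g0.
  apply/nbhs_ballP; exists e => //= y; rewrite -ball_normE /= => /He.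
  by move=> + ; rewrite /= => h; right => Gy; move: h; rewrite Gy subrr subr0 ltxx.
have := filter_forall (nbhs_filter x) near_j; apply: filterS => y near_y.
have [j Gy] := GA y.
have : (A i, b i) = (A j, b j) \/ G y <> A j *m y + b j by exact: near_y.
by case=> [[-> ->]|].
Qed.

(** A cutoff joins [H] near the origin to [G] far away; since [c < rho], this creates no zero in the
    transition region. *)
Lemma coherent_surjective (R : realType) n k (G H : 'cV[R]_n.+1 -> 'cV[R]_n.+1)
    (A : 'I_k -> 'M[R]_n.+1) (b : 'I_k -> 'cV[R]_n.+1) (rho c C : R) :
  continuous G -> continuous H -> composed_of G A b ->
  (forall i, A i \in unitmx) -> coherently_oriented A ->
  (forall i (x : 'cV[R]_n.+1), rho * `|x| <= `|A i *m x|) ->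
  (forall x, `|G x - H x| <= c * `|x| + C) -> 0 <= c -> c < rho ->
  forall y, exists x, H x = y.
Proof.
move=> cG cH GA Au [s s0 sA] Arho GH c0 crho y.
have [x0 Hx0] := composed_of_regular_value cG GA Au.
pose G1 x := G (x0 + x) - G x0; pose H1 x := H (x0 + x) - y.
pose b1 i := A i *m x0 + b i - G x0.
have GA1 x i : (G (x0 + x) = A i *m (x0 + x) + b i) <-> (G1 x = A i *m x + b1 i).
  rewrite /G1 /b1 mulmxDr; split=> [->|/(congr1 (fun z => z + G x0))].
    by rewrite [A i *m x0 + _]addrC -!addrA.
  by rewrite subrK => ->; rewrite -!addrA addNr addr0 addrCA.
have cG1 : continuous G1.
  exact: (@continuous_translate R 'cV[R]_n.+1 'cV[R]_n.+1 G x0 (G x0) cG).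
have cH1 : continuous H1.
  exact: (@continuous_translate R 'cV[R]_n.+1 'cV[R]_n.+1 H x0 y cH).
pose C1 := \sum_i `|b1 i|.
have G1ge x : rho * `|x| - C1 <= `|G1 x|.
  have [i /GA1 ->] := GA (x0 + x).
  have : `|b1 i| <= C1 by rewrite /C1 (bigD1 i) //= lerDl sumr_ge0.
  have := lerB_normD (A i *m x) (b1 i); have := Arho i x; lra.
pose C2 := c * `|x0| + C + `|y - G x0|.
have GH1 x : `|G1 x - H1 x| <= c * `|x| + C2.
  have -> : G1 x - H1 x = (G (x0 + x) - H (x0 + x)) + (y - G x0).
    by rewrite /G1 /H1 opprB addrACA [RHS]addrACA; congr (_ + _); exact: addrC.
  apply: le_trans (ler_normD _ _) _; have := GH (x0 + x).
  have : c * `|x0 + x| <= c * (`|x0| + `|x|) by rewrite ler_wpM2l // ler_normD.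
  rewrite /C2; lra.
(* From this radius on, [rho * |x| - C1] exceeds [c * |x| + C2]. *)
pose r := (`|C1 + C2| + 1) / (rho - c).
have rc0 : 0 < rho - c by rewrite subr_gt0.
have r0 : 0 < r by rewrite divr_gt0 // ltr_wpDl.
have far x : r <= `|x| -> `|G1 x - H1 x| < `|G1 x|.
  rewrite ler_pdivrMr // => xr; have := ler_norm (C1 + C2).
  have := G1ge x; have := GH1 x; lra.
pose chi (x : 'cV[R]_n.+1) := Num.max 0 (Num.min 1 (2 - r^-1 * `|x|)).
pose Hc x := G1 x + chi x *: (H1 x - G1 x).
have chi01 x : 0 <= chi x <= 1.
  by rewrite /chi le_max lexx /= ge_max ler01 ge_min lexx.
have cHc : continuous Hc.
  have cchi := @continuous_cutoff R 'cV[R]_n.+1 r.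
  exact: (@continuous_blend R 'cV[R]_n.+1 'cV[R]_n.+1 G1 H1 chi cG1 cH1 cchi).
have [||x Gx|x] := @coherent_zero _ _ _ G1 Hc A b1 s (2 * r) cG1 cHc _ _ _ s0 sA.
- move=> x rx; rewrite /Hc (_ : chi x = 0) ?scale0r ?addr0 //.
  rewrite /chi; apply/max_idPl; rewrite ge_min; apply/orP; right.
  by rewrite subr_le0 mulrC ler_pdivlMr.
- by rewrite /G1 addr0 subrr.
- have /Hx0[i Hi] : G (x0 + x) = G x0 by move/subr0_eq: Gx.
  exists i; have : \forall z \near x, G (x0 + z) = A i *m (x0 + z) + b i.
    have cx := @continuous_addl R 'cV[R]_n.+1 x0.
    exact: (cx x _ Hi).
  by apply: filterS => z /GA1.
move=> Hcx; exists (x0 + x).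
(* At a zero of the blend, [|G1 x|] is [chi x] times [|G1 x - H1 x|], which [far] excludes beyond
   [r]; below [r] the cutoff is 1. *)
have xr : `|x| < r.
  rewrite ltNge; apply/negP => /far; apply/negP; rewrite -leNgt.
  have /andP[chi0 chi1] := chi01 x.
  have -> : `|G1 x| = chi x * `|G1 x - H1 x|.
    by have /eqP := Hcx; rewrite addr_eq0 => /eqP {1}->;
      rewrite normrN normrZ ger0_norm // distrC.
  by rewrite -[leRHS]mul1r ler_wpM2r.
have chi1 : chi x = 1.
  have h : 1 <= 2 - r^-1 * `|x|.
    have : r^-1 * `|x| <= 1 by rewrite mulrC ler_pdivrMr // mul1r ltW.
    lra.
  by rewrite /chi (min_idPl h) max_r.
by move: Hcx; rewrite /Hc chi1 scale1r addrC subrK => /subr0_eq.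
Qed.

(** * Derivatives of the elementals *)

Lemma compact_locally_lipschitz (R : realType) (X : set R) (g : R -> R) :
  compact X ->
  (forall t, X t -> exists2 U : set R, nbhs t U & exists k : R, k.-lipschitz_U g) ->
  (exists B, forall t, X t -> `|g t| <= B) /\
  (exists2 L, 0 <= L & L.-lipschitz_X g).
Proof.
move=> Xc loc.
have {}loc t : X t -> exists2 e, 0 < e & exists2 k, 0 < k & forall x y : R,
    `|t - x| < e -> `|t - y| < e -> `|g x - g y| <= k * `|x - y|.
  move=> /loc[U /nbhs_ballP[e /= e0 eU] [k gk]]; exists e => //.
  exists (`|k| + 1) => [|x y tx ty]; first by rewrite ltr_wpDl.
  have Uxy : (U `*` U) (x, y) by split=> /=; apply: eU; rewrite -ball_normE.
  apply: le_trans (gk _ Uxy) _; rewrite ler_wpM2r // (le_trans (ler_norm k)) // lerDl //.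
(* The guard [0 < e] makes the family antitone over all real [e] despite the inverse. *)
pose ZB (_ : unit) (e : R) := [set y | 0 < e -> `|g y| <= e^-1].
have ZBm i e e' : e' <= e -> ZB i e `<=` ZB i e'.
  move=> ee y /= gy e0; have e0' := lt_le_trans e0 ee.
  by apply: le_trans (gy e0') _; rewrite lef_pV2.
have [t Xt|e e0 He] := lebesgue_number Xc ZBm.
  have [e e0 [k k0 gk]] := loc t Xt.
  pose b := `|g t| + k * e + 1.
  have b0 : 0 < b by rewrite ltr_wpDl // addr_ge0 // mulr_ge0 // ltW.
  exists (Num.min e b^-1); first by rewrite lt_min e0 invr_gt0.
  exists tt => y; rewrite lt_min => /andP[ty _] m0.
  have gty := gk t y; rewrite subrr normr0 in gty; have {}gty := gty e0 ty.
  have gb : `|g y| <= b.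
    have := ler_distD (g t) (g y) 0; rewrite !subr0 distrC => h.
    have : k * `|t - y| <= k * e by rewrite ler_wpM2l // ltW.
    rewrite /b; lra.
  apply: le_trans gb _; rewrite -[leLHS]invrK lef_pV2 ?posrE ?invr_gt0 //.
  by rewrite ge_min lexx orbT.
pose B := e^-1.
have gB t : X t -> `|g t| <= B.
  by move=> /He[i]; apply=> //; rewrite subrr normr0.
split; first by exists B.
pose Z (U : set R) (d : R) := [set y | 0 < d -> U y /\
   forall x y : R, U x -> U y -> `|g x - g y| <= d^-1 * `|x - y|].
have Zm i d d' : d' <= d -> Z i d `<=` Z i d'.
  move=> dd y /= gy d0; have d0' := lt_le_trans d0 dd; have [iy gi] := gy d0'.
  split=> // x z ix iz; apply: le_trans (gi x z ix iz) _.
  by rewrite ler_wpM2r // lef_pV2.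
have [t Xt|d d0 Hd] := lebesgue_number Xc Zm.
  have [d d0 [k k0 gk]] := loc t Xt.
  exists (Num.min d k^-1); first by rewrite lt_min d0 invr_gt0.
  exists [set y | `|t - y| < d] => y; rewrite lt_min => /andP[ty _] m0; split=> // x z tx tz.
  apply: le_trans (gk x z tx tz) _; rewrite ler_wpM2r //.
  rewrite -[leLHS]invrK lef_pV2 ?posrE ?invr_gt0 //.
  by rewrite ge_min lexx orbT.
have B0 : 0 <= B by rewrite invr_ge0 ltW.
exists (d^-1 + 2 * B / d) => [|[x y] [/= Xx Xy]].
  by rewrite addr_ge0 ?invr_ge0 ?divr_ge0 ?mulr_ge0 // ltW.
(* Close points share a neighbourhood with a Lipschitz bound; for points at distance at least [d],
   the bound [B] on the values suffices. *)
rewrite mulrDl; have [xy|xy] := ltP `|x - y| d.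
  have [U HU] := Hd x Xx; have [|Ux gU] := HU x _ d0; first by rewrite subrr normr0.
  have [Uy _] := HU y xy d0; apply: le_trans (gU _ _ Ux Uy) _.
  by rewrite lerDl mulr_ge0 // divr_ge0 ?mulr_ge0 // ltW.
apply: le_trans (_ : 2 * B <= _).
  by rewrite (le_trans (ler_normB _ _)) // mulr2n mulrDl mul1r lerD // gB.
rewrite -[leLHS]add0r lerD //; first by rewrite mulr_ge0 // invr_ge0 ltW.
by rewrite mulrAC ler_pdivlMr // ler_wpM2l // mulr_ge0.
Qed.

(** The last clause expresses that [xi] lies between [a] and [b], in the form needed to estimate the
    variation of the derivative. *)
Lemma slope_mean_value (R : realType) (X : set R) (phi : elemental R) a b :
  is_interval X -> X `<=` elem_dom phi -> X a -> X b ->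
  exists xi, [/\ X xi, slope phi a b = derive1 phi xi &
    forall t d, `|t - a| <= d -> `|t - b| <= d -> `|t - xi| <= d].
Proof.
move=> Xi Xdom.
have mid x y c : x <= c <= y -> forall t d : R, `|t - x| <= d -> `|t - y| <= d -> `|t - c| <= d.
  move=> /andP[xc cy] t d; rewrite !ler_distlC => /andP[h1 h2] /andP[h3 h4].
  by apply/andP; split; lra.
have mvt x y : X x -> X y -> x < y -> exists2 c, x <= c <= y &
    phi y - phi x = derive1 phi c * (y - x).
  move=> Xx Xy xy.
  have dom c : x <= c <= y -> elem_dom phi c by move=> h; apply/Xdom/(Xi x y).
  have [||c] := @MVT_segment R phi (derive1 phi) x y (ltW xy).
  - move=> c; rewrite in_itv /= => /andP[/ltW h1 /ltW h2].
    rewrite derive1E; apply/derivableP/elem_derivable/dom; by rewrite h1.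
  - apply: derivable_within_continuous => c; rewrite in_itv /= => h.
    exact/elem_derivable/dom.
  by rewrite in_itv /= => h ?; exists c.
move=> Xa Xb; rewrite /slope; case: ltgtP => [ab|ba|ab].
- have [c cab E] := mvt _ _ Xa Xb ab; exists c; split.
  + exact: (Xi a b).
  + rewrite -opprB E -mulrN opprB mulfK // lt_eqF // subr_lt0 //.
  + by move=> t d; exact: mid.
- have [c cba E] := mvt _ _ Xb Xa ba; exists c; split.
  + exact: (Xi b a).
  + by rewrite E mulfK // gt_eqF // subr_gt0.
  + by move=> t d ta tb; exact: (mid b a).
- exists a; split => //; rewrite -ab; congr (derive1 _ _); lra.
Qed.

Lemma slope_mul (R : realType) (phi : R -> R) a b :
  phi a - phi b = slope phi a b * (a - b).
Proof.
by rewrite /slope; case: eqVneq => [->|ab]; rewrite /= ?subrr ?mulr0 // divfK // subr_eq0.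
Qed.

Section derivative_constants.
Variables (R : realType) (n : nat) (K : set 'cV[R]_n) (phi : elemental R) (u : 'cV[R]_n -> R).
Hypotheses (Xc : compact (u @` K)) (Xdom : u @` K `<=` elem_dom phi).

Let facts : (exists B, forall t, (u @` K) t -> `|derive1 phi t| <= B) /\
  (exists2 L, 0 <= L & L.-lipschitz_(u @` K) (derive1 phi)).
Proof. by apply: compact_locally_lipschitz => // t /Xdom; exact: elem_loclip. Qed.

Lemma max_abs_deriv_ub t : (u @` K) t -> `|derive1 phi t| <= max_abs_deriv K phi u.
Proof.
move=> [x Kx <-]; apply: ub_le_sup; last by exists x.
have [[B HB] _] := facts; exists B => _ [y Ky <-]; apply: HB; by exists y.
Qed.

Lemma lip_const_deriv_ge0 : 0 <= lip_const_deriv K phi u.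
Proof.
have [_ [L L0 HL]] := facts.
by apply: lb_le_inf => [|y []//]; exists L.
Qed.

Lemma lip_const_deriv_lip s t : (u @` K) s -> (u @` K) t ->
  `|derive1 phi s - derive1 phi t| <= lip_const_deriv K phi u * `|s - t|.
Proof.
move=> Xs Xt; have [->|st] := eqVneq s t; first by rewrite !subrr normr0 mulr0.
have st0 : 0 < `|s - t| by rewrite normr_gt0 subr_eq0.
rewrite -ler_pdivrMr //; have [_ [L L0 HL]] := facts.
apply: lb_le_inf => [|y [y0 Hy]]; first by exists L.
by rewrite ler_pdivrMr //; exact: (Hy (s, t)).
Qed.

Lemma max_abs_deriv_ge0 : K !=set0 -> 0 <= max_abs_deriv K phi u.
Proof.
by move=> [x Kx]; apply: le_trans (max_abs_deriv_ub (t := u x) _) => //; exists x.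
Qed.
End derivative_constants.

(** * Growth of the models *)

Lemma append_last (T : Type) N (v : 'I_N -> T) w : append v w ord_max = w.
Proof. by rewrite /append unlift_none. Qed.

Lemma append_lift (T : Type) N (v : 'I_N -> T) w j : append v w (lift ord_max j) = v j.
Proof. by rewrite /append liftK. Qed.

Lemma convex_image_interval (R : realType) (U : normedModType R) (K : set U) (u : U -> R) :
  convex_set K -> continuous u -> is_interval (u @` K).
Proof.
move=> Kc cu _ _ [x Kx <-] [y Ky <-] z /andP[xz zy].
pose f (t : R) := u (t *: x + (1 - t) *: y).
have f0 : f 0 = u y by rewrite /f scale0r add0r subr0 scale1r.
have f1 : f 1 = u x by rewrite /f scale1r subrr scale0r addr0.
have cf : continuous f.
  move=> t; apply: continuous_comp; last exact: cu.
  apply: cvgD; apply: cvgZr_tmp.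
    exact: cvg_id.
  by apply: cvgB; [exact: cvg_cst|exact: cvg_id].
have [||t] := @IVT R f 0 1 z ler01.
- exact: continuous_subspaceT.
- by rewrite f0 f1 ge_min xz orbT le_max zy.
rewrite in_itv /= => /andP[t0 t1] ftz.
exists (t *: x + (1 - t) *: y) => //.
have xK : x \in K by rewrite inE.
have yK : y \in K by rewrite inE.
by have := Kc x y (Itv01 t0 t1) xK yK; rewrite inE.
Qed.

Section real_continuity.
Variables (R : realType) (U : normedModType R).

Lemma continuous_addR (f g : U -> R) :
  continuous f -> continuous g -> continuous (fun x => f x + g x).
Proof. by move=> cf cg x; apply: cvgD; [exact: cf|exact: cg]. Qed.

Lemma continuous_normR (f : U -> R) : continuous f -> continuous (fun x => `|f x|).
Proof. by move=> cf x; apply: cvg_norm; exact: cf. Qed.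

Lemma continuous_elemental (phi : elemental R) (f : U -> R) :
  (forall x, elem_dom phi (f x)) -> continuous f -> continuous (fun x => phi (f x)).
Proof.
move=> fdom cf x; apply: continuous_comp; first exact: cf.
exact/differentiable_continuous/derivable1_diffP/elem_derivable.
Qed.

End real_continuity.

Lemma continuous_value (R : realType) n l (p : slp R n l) i :
  admissible p -> continuous (value p ^~ i).
Proof.
elim: p i => [|l' q IH j k|l' q IH j|l' q IH phi j] i.
- by move=> _; exact: coord_continuous.
- move=> /= aq; case: (unliftP ord_max i) => [i' ->|->].
    rewrite (_ : (fun x => _) = value q ^~ i'); first exact: IH.
    by apply/funext => x; rewrite append_lift.
  rewrite (_ : (fun x => _) = fun x => value q x j + value q x k).
    exact: (@continuous_addR R 'cV[R]_n _ _ (IH j aq) (IH k aq)).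
  by apply/funext => x; rewrite append_last.
- move=> /= aq; case: (unliftP ord_max i) => [i' ->|->].
    rewrite (_ : (fun x => _) = value q ^~ i'); first exact: IH.
    by apply/funext => x; rewrite append_lift.
  rewrite (_ : (fun x => _) = fun x => `|value q x j|).
    exact: (@continuous_normR R 'cV[R]_n _ (IH j aq)).
  by apply/funext => x; rewrite append_last.
- move=> /= [aq dom]; case: (unliftP ord_max i) => [i' ->|->].
    rewrite (_ : (fun x => _) = value q ^~ i'); first exact: IH.
    by apply/funext => x; rewrite append_lift.
  rewrite (_ : (fun x => _) = fun x => phi (value q x j)).
    exact: (@continuous_elemental R 'cV[R]_n phi _ dom (IH j aq)).
  by apply/funext => x; rewrite append_last.
Qed.

Lemma increment_lipschitz (R : realType) n l (p : slp R n l) (zc zh : 'cV[R]_n) i :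
  exists2 c, 0 <= c & forall x y : 'cV[R]_n,
    `|increment p zc zh x i - increment p zc zh y i| <= c * `|x - y|.
Proof.
elim: p i => [|l' q IH j k|l' q IH j|l' q IH phi j] i.
- exists 1 => // x y; rewrite mul1r; have := cV_norm_ge (x - y) i.
  by rewrite !mxE.
- case: (unliftP ord_max i) => [i' ->|->].
    by have [c c0 Hc] := IH i'; exists c => // x y; rewrite /= !append_lift.
  have [c c0 Hc] := IH j; have [d d0 Hd] := IH k; exists (c + d); first exact: addr_ge0.
  move=> x y; rewrite /= !append_last opprD addrACA mulrDl.
  by apply: le_trans (ler_normD _ _) _; rewrite lerD.
- case: (unliftP ord_max i) => [i' ->|->].
    by have [c c0 Hc] := IH i'; exists c => // x y; rewrite /= !append_lift.
  have [c c0 Hc] := IH j; exists c => // x y; rewrite /= !append_last.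
  rewrite opprB addrA subrK; apply: le_trans (Hc x y).
  apply: le_trans (ler_dist_dist _ _) _.
  by rewrite opprD addrACA subrr add0r.
- case: (unliftP ord_max i) => [i' ->|->].
    by have [c c0 Hc] := IH i'; exists c => // x y; rewrite /= !append_lift.
  have [c c0 Hc] := IH j; set s := slope phi (value q zc j) (value q zh j).
  exists (`|s| * c) => [|x y]; first exact: mulr_ge0.
  by rewrite /= !append_last -mulrBr normrM -mulrA ler_wpM2l.
Qed.

Lemma continuous_secant_model (R : realType) n l (p : slp R n l) (zc zh : 'cV[R]_n) :
  continuous (secant_model p zc zh).
Proof.
have inc := increment_lipschitz p zc zh.
pose c i := projT1 (cid2 (inc (rshift l i))).
have c0 i : 0 <= c i by rewrite /c; case: cid2.
have Hc i x y : `|increment p zc zh x (rshift l i) - increment p zc zh y (rshift l i)|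
    <= c i * `|x - y| by move: x y; rewrite /c; case: cid2.
apply: (@lipschitz_continuous _ _ _ _ (\sum_i c i)) => x y.
have c_ge0 : 0 <= \sum_i c i by rewrite sumr_ge0.
apply: cV_norm_le => [|i]; first by rewrite mulr_ge0.
rewrite /secant_model opprD addrACA subrr add0r !mxE.
apply: le_trans (Hc i _ _) _; rewrite opprB addrA subrK ler_wpM2r //.
by rewrite (bigD1 i) //= lerDl sumr_ge0.
Qed.

Section model_bounds.
Variables (R : realType) (n : nat) (K : set 'cV[R]_n).
Hypotheses (Kc : compact K) (Kconv : convex_set K) (K0 : K !=set0).

Let value_compact l (q : slp R n l) j : admissible q -> compact ((value q ^~ j) @` K).
Proof.
by move=> aq; apply: continuous_compact Kc; apply/continuous_subspaceT/continuous_value.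
Qed.

Let value_interval l (q : slp R n l) j : admissible q -> is_interval ((value q ^~ j) @` K).
Proof.
by move=> aq; apply: (@convex_image_interval R 'cV[R]_n) => //; exact: continuous_value.
Qed.

Let value_dom l (q : slp R n l) j (phi : elemental R) :
  (forall x, elem_dom phi (value q x j)) -> (value q ^~ j) @` K `<=` elem_dom phi.
Proof. by move=> dom _ [x _ <-]. Qed.

Lemma beta_gamma_ge0 l (p : slp R n l) i : admissible p ->
  0 <= beta K p i /\ 0 <= gamma K p i.
Proof.
elim: p i => [|l' q IH j k|l' q IH j|l' q IH phi j] i /=.
- by move=> _; split; rewrite ?ler01.
- move=> aq; case: (unliftP ord_max i) => [i' ->|->]; rewrite !(append_lift, append_last).
    exact: IH.
  by have [? ?] := IH j aq; have [? ?] := IH k aq; rewrite !addr_ge0.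
- by move=> aq; case: (unliftP ord_max i) => [i' ->|->];
    rewrite !(append_lift, append_last); exact: IH.
- move=> [aq dom]; case: (unliftP ord_max i) => [i' ->|->];
    rewrite !(append_lift, append_last); first exact: IH.
  have [b0 g0] := IH j aq.
  have M0 := max_abs_deriv_ge0 (value_compact aq) (value_dom dom) K0.
  have L0 := lip_const_deriv_ge0 (value_compact aq) (value_dom dom).
  by rewrite addr_ge0 ?mulr_ge0 // exprn_ge0.
Qed.

Lemma value_lipschitz l (p : slp R n l) i x y : admissible p -> K x -> K y ->
  `|value p x i - value p y i| <= beta K p i * `|x - y|.
Proof.
move=> + Kx Ky; elim: p i => [|l' q IH j k|l' q IH j|l' q IH phi j] i.
- by move=> _ /=; rewrite mul1r; have := cV_norm_ge (x - y) i; rewrite !mxE.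
- move=> /= aq; case: (unliftP ord_max i) => [i' ->|->]; rewrite !(append_lift, append_last).
    exact: IH.
  rewrite opprD addrACA mulrDl; apply: le_trans (ler_normD _ _) _.
  by rewrite lerD // IH.
- move=> /= aq; case: (unliftP ord_max i) => [i' ->|->]; rewrite !(append_lift, append_last).
    exact: IH.
  exact: le_trans (ler_dist_dist _ _) (IH _ aq).
- move=> /= [aq dom]; case: (unliftP ord_max i) => [i' ->|->]; rewrite !(append_lift, append_last).
    exact: IH.
  have Xx : (value q ^~ j @` K) (value q x j) by exists x.
  have Xy : (value q ^~ j @` K) (value q y j) by exists y.
  have [xi [Xxi sE _]] := slope_mean_value (value_interval aq) (value_dom dom) Xx Xy.
  rewrite slope_mul normrM sE [leLHS]mulrC [leRHS]mulrAC.
  rewrite ler_pM ?IH //; exact: (max_abs_deriv_ub (value_compact aq) (value_dom dom)).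
Qed.

(** The linearization of one intermediate value. Unlike increments, these propagate without
    correction terms: sums to sums, absolute values to absolute values, and smooth elementals to
    affine maps. *)
Definition model_value l (p : slp R n l) (zc zh x : 'cV[R]_n) i :=
  (value p zc i + value p zh i) / 2 + increment p zc zh (x - 2^-1 *: (zc + zh)) i.

Lemma secant_modelE l (p : slp R n l) (zc zh x : 'cV[R]_n) i :
  secant_model p zc zh x i 0 = model_value p zc zh x (rshift l i).
Proof. by rewrite !mxE mulrC. Qed.

Lemma model_value_smooth l (q : slp R n l) (phi : elemental R) j zc zh x :
  model_value (Smooth q phi j) zc zh x ord_max =
  slope phi (value q zc j) (value q zh j) * model_value q zc zh x j +
  ((phi (value q zc j) + phi (value q zh j)) / 2 -
   slope phi (value q zc j) (value q zh j) * ((value q zc j + value q zh j) / 2)).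
Proof. by rewrite /model_value /= !append_last mulrDr; ring. Qed.

Lemma model_value_growth l (p : slp R n l) zc zh i : admissible p -> K zc -> K zh ->
  exists C, forall x, `|model_value p zc zh x i| <= beta K p i * `|x| + C.
Proof.
move=> + Kzc Kzh; elim: p i => [|l' q IH j k|l' q IH j|l' q IH phi j] i.
- move=> _; exists 0 => x; rewrite /model_value /= mul1r addr0 !mxE.
  apply: le_trans (cV_norm_ge x i); rewrite le_eqVlt; apply/orP; left; apply/eqP.
  by congr `|_|; field.
- move=> /= aq; case: (unliftP ord_max i) => [i' ->|->].
    have [C HC] := IH i' aq; exists C => x.
    by rewrite /model_value /= !append_lift; exact: HC.
  have [C HC] := IH j aq; have [D HD] := IH k aq; exists (C + D) => x.
  have -> : model_value (Add q j k) zc zh x ord_max =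
      model_value q zc zh x j + model_value q zc zh x k.
    by rewrite /model_value /= !append_last; ring.
  rewrite append_last mulrDl [leRHS]addrACA; apply: le_trans (ler_normD _ _) _.
  by apply: lerD; [exact: HC|exact: HD].
- move=> /= aq; case: (unliftP ord_max i) => [i' ->|->].
    have [C HC] := IH i' aq; exists C => x.
    by rewrite /model_value /= !append_lift; exact: HC.
  have [C HC] := IH j aq; exists C => x.
  have -> : model_value (Abs q j) zc zh x ord_max = `|model_value q zc zh x j|.
    by rewrite /model_value /= !append_last addrC subrK.
  by rewrite append_last normr_id.
- move=> /= [aq dom]; case: (unliftP ord_max i) => [i' ->|->].
    have [C HC] := IH i' aq; exists C => x.
    by rewrite /model_value /= !append_lift; exact: HC.
  have [C HC] := IH j aq; have [b0 _] := beta_gamma_ge0 j aq.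
  have Xc : (value q ^~ j @` K) (value q zc j) by exists zc.
  have Xh : (value q ^~ j @` K) (value q zh j) by exists zh.
  have [xi [Xxi sE _]] := slope_mean_value (value_interval aq) (value_dom dom) Xc Xh.
  have sM := max_abs_deriv_ub (value_compact aq) (value_dom dom) Xxi.
  rewrite append_last; eexists => x; rewrite model_value_smooth.
  apply: le_trans (ler_normD _ _) _; rewrite normrM sE.
  have := ler_pM (normr_ge0 _) (normr_ge0 _) sM (HC x).
  set M := max_abs_deriv _ _ _; rewrite mulrDr mulrCA mulrA => h.
  by apply: le_trans (lerD h (lexx _)) _; rewrite -addrA; exact: lexx.
Qed.

(** The absolute value is 1-Lipschitz, so only smooth elementals add to the error. There the
    variation of the slope meets the growth of the model, which gives the term in [beta ^+ 2]. *)
Lemma model_value_dist l (p : slp R n l) xo zc zh d i : admissible p ->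
  K xo -> K zc -> K zh -> `|xo - zc| <= d -> `|xo - zh| <= d ->
  exists C, forall x, `|model_value p xo xo x i - model_value p zc zh x i| <=
    gamma K p i * d * `|x| + C.
Proof.
move=> + Kxo Kzc Kzh dc dh; elim: p i => [|l' q IH j k|l' q IH j|l' q IH phi j] i.
- move=> _; exists 0 => x; rewrite /model_value /= !mul0r addr0 !mxE.
  by rewrite normr_le0; apply/eqP; field.
- move=> /= aq; case: (unliftP ord_max i) => [i' ->|->].
    have [C HC] := IH i' aq; exists C => x.
    by rewrite /model_value /= !append_lift; exact: HC.
  have [C HC] := IH j aq; have [D HD] := IH k aq; exists (C + D) => x.
  have E yc yh : model_value (Add q j k) yc yh x ord_max =
      model_value q yc yh x j + model_value q yc yh x k.
    by rewrite /model_value /= !append_last; ring.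
  rewrite !E append_last opprD addrACA !mulrDl [leRHS]addrACA.
  by apply: le_trans (ler_normD _ _) _; apply: lerD; [exact: HC|exact: HD].
- move=> /= aq; case: (unliftP ord_max i) => [i' ->|->].
    have [C HC] := IH i' aq; exists C => x.
    by rewrite /model_value /= !append_lift; exact: HC.
  have [C HC] := IH j aq; exists C => x.
  have E yc yh : model_value (Abs q j) yc yh x ord_max = `|model_value q yc yh x j|.
    by rewrite /model_value /= !append_last addrC subrK.
  by rewrite !E append_last; exact: le_trans (ler_dist_dist _ _) (HC x).
- move=> /= [aq dom]; case: (unliftP ord_max i) => [i' ->|->].
    have [C HC] := IH i' aq; exists C => x.
    by rewrite /model_value /= !append_lift; exact: HC.
  have [C HC] := IH j aq; have [D HD] := model_value_growth j aq Kxo Kxo.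
  have [b0 g0] := beta_gamma_ge0 j aq.
  have d0 : 0 <= d by apply: le_trans dc.
  have Xo : (value q ^~ j @` K) (value q xo j) by exists xo.
  have Xc : (value q ^~ j @` K) (value q zc j) by exists zc.
  have Xh : (value q ^~ j @` K) (value q zh j) by exists zh.
  have [xi [Xxi sE xi_d]] := slope_mean_value (value_interval aq) (value_dom dom) Xc Xh.
  have [xj [Xxj tE xj_d]] := slope_mean_value (value_interval aq) (value_dom dom) Xo Xo.
  have sM := max_abs_deriv_ub (value_compact aq) (value_dom dom) Xxi.
  have bd z : K z -> `|xo - z| <= d -> `|value q xo j - value q z j| <= beta K q j * d.
    move=> Kz zd; apply: le_trans (value_lipschitz j aq Kxo Kz) _; exact: ler_wpM2l.
  have xjE : xj = value q xo j.
    by apply/eqP; rewrite eq_sym -subr_eq0 -normr_le0; apply: xj_d; rewrite subrr normr0.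
  have xo_xi := xi_d _ _ (bd _ Kzc dc) (bd _ Kzh dh).
  have stL : `|derive1 phi xj - derive1 phi xi| <=
      lip_const_deriv K phi (value q ^~ j) * (beta K q j * d).
    apply: le_trans (lip_const_deriv_lip (value_compact aq) (value_dom dom) Xxj Xxi) _.
    rewrite ler_wpM2l ?xjE //; exact: (lip_const_deriv_ge0 (value_compact aq) (value_dom dom)).
  rewrite append_last; eexists => x; rewrite !model_value_smooth sE tE.
  set M := max_abs_deriv _ _ _ in sM *; set L := lip_const_deriv _ _ _ in stL *.
  set a := model_value q xo xo x j; set a' := model_value q zc zh x j.
  set ka := (X in _ + X - _); set kb := (X in _ - (_ + X)).
  (* The first product yields [M * gamma]. In the second, the slopes differ by at most
     [L * beta * d] and [a] grows like [beta * |x|]. *)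
  have -> : derive1 phi xj * a + ka - (derive1 phi xi * a' + kb) =
    derive1 phi xi * (a - a') + (derive1 phi xj - derive1 phi xi) * a + (ka - kb) by ring.
  apply: le_trans (ler_normD _ _) _.
  have h1 : `|derive1 phi xi * (a - a') + (derive1 phi xj - derive1 phi xi) * a| <=
     M * (gamma K q j * d * `|x| + C) + L * (beta K q j * d) * (beta K q j * `|x| + D).
    apply: le_trans (ler_normD _ _) _; rewrite !normrM; apply: lerD.
      by apply: ler_pM => //; exact: HC.
    by apply: ler_pM => //; exact: HD.
  apply: le_trans (lerD h1 (lexx _)) _.
  rewrite [leLHS](_ : _ = (M * gamma K q j + L * beta K q j ^+ 2) * d * `|x| +
    (M * C + L * (beta K q j * d) * D + `|ka - kb|)); last by ring.
  exact: lexx.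
Qed.

End model_bounds.

(** * Induced norms and conclusion *)

Lemma induced_norm_ub (R : realType) n (B : 'M[R]_n) (x : 'cV[R]_n) :
  `|B *m x| <= induced_norm B * `|x|.
Proof.
have [->|x0] := eqVneq x 0; first by rewrite mulmx0 normr0 mulr0.
have nx0 : 0 < `|x| by rewrite normr_gt0.
rewrite -ler_pdivrMr //.
have -> : `|B *m x| / `|x| = `|B *m (`|x|^-1 *: x)|.
  by rewrite -scalemxAr normrZ normfV normr_id mulrC.
apply: ub_le_sup.
  exists (\sum_i \sum_j `|B i j|) => _ [y /= y1 <-].
  apply: le_trans (mulmx_norm_le _ _) _; rewrite ler_piMr // sumr_ge0 // => i _.
  exact: sumr_ge0.
exists (`|x|^-1 *: x) => //=.
by rewrite normrZ normfV normr_id mulVf // gt_eqF.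
Qed.

Lemma induced_norm_ge0 (R : realType) n (B : 'M[R]_n) : 0 <= induced_norm B.
Proof.
apply: ub_le_sup; last by exists 0; rewrite /= ?mulmx0 normr0.
exists (\sum_i \sum_j `|B i j|) => _ [y /= y1 <-].
apply: le_trans (mulmx_norm_le _ _) _; rewrite ler_piMr // sumr_ge0 // => i _.
exact: sumr_ge0.
Qed.

Lemma induced_norm_gt0 (R : realType) n (B : 'M[R]_n.+1) : B \in unitmx -> 0 < induced_norm B.
Proof.
move=> Bu; rewrite lt_neqAle induced_norm_ge0 andbT eq_sym; apply/eqP => B0.
have := induced_norm_ub B (invmx B *m const_mx 1).
rewrite B0 mul0r mulKVmx // normr_le0 => /eqP/colP/(_ ord0)/eqP.
by rewrite !mxE oner_eq0.
Qed.

Lemma rho_le (R : realType) n k (A : 'I_k.+1 -> 'M[R]_n) i (x : 'cV[R]_n) :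
  A i \in unitmx -> rho A * `|x| <= `|A i *m x|.
Proof.
move=> Au; have rhoi : rho A <= (induced_norm (invmx (A i)))^-1.
  exact: bigmin_le_cond.
apply: le_trans (ler_wpM2r _ rhoi) _ => //.
have := induced_norm_ub (invmx (A i)) (A i *m x); rewrite mulKmx //.
(* The norm of an inverse is 0 only in dimension 0, where its inverse takes the default value 0. *)
have := induced_norm_ge0 (invmx (A i)); rewrite le_eqVlt => /orP[/eqP <-|N0 h].
  by rewrite invr0 !mul0r.
by rewrite mulrC ler_pdivrMr // mulrC.
Qed.

Lemma rho_gt0 (R : realType) n k (A : 'I_k.+1 -> 'M[R]_n.+1) :
  (forall i, A i \in unitmx) -> 0 < rho A.
Proof.
move=> Au; have pos i : 0 < (induced_norm (invmx (A i)))^-1.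
  by rewrite invr_gt0 induced_norm_gt0 // unitmx_inv.
by apply: (big_ind (fun x => 0 < x)) => // x y x0 y0; rewrite lt_min x0.
Qed.

Lemma secant_model_dist (R : realType) n l (p : slp R n l) (K : set 'cV[R]_n) xo zc zh d :
  admissible p -> compact K -> convex_set K -> K xo -> K zc -> K zh ->
  `|xo - zc| <= d -> `|xo - zh| <= d ->
  exists C, forall x : 'cV[R]_n, `|tangent_model p xo x - secant_model p zc zh x| <=
    gamma_fun K p * d * `|x| + C.
Proof.
move=> ap Kc Kv Kxo Kzc Kzh dc dh.
have K0 : K !=set0 by exists xo.
have d0 : 0 <= d := le_trans (normr_ge0 _) dc.
have bound i := @cid _ _ (model_value_dist Kc Kv K0 (rshift l i) ap Kxo Kzc Kzh dc dh).
pose C i := sval (bound i).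
have HC i x : `|model_value p xo xo x (rshift l i) - model_value p zc zh x (rshift l i)| <=
    gamma K p (rshift l i) * d * `|x| + C i by exact: (svalP (bound i)).
have g0 : 0 <= gamma_fun K p by exact: bigmax_ge_id.
exists (\sum_i `|C i|) => x; apply: cV_norm_le => [|i].
  by rewrite addr_ge0 ?mulr_ge0 // sumr_ge0.
have -> : (tangent_model p xo x - secant_model p zc zh x) i 0 =
    model_value p xo xo x (rshift l i) - model_value p zc zh x (rshift l i).
  by rewrite -!secant_modelE [LHS]mxE; congr (_ + _); rewrite mxE.
apply: le_trans (HC i x) _; apply: lerD.
  rewrite !ler_wpM2r //.
  exact: (le_bigmax 0 (fun i => gamma K p (rshift l i)) i).
by rewrite (bigD1 i) //= (le_trans (ler_norm _)) // lerDl sumr_ge0.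
Qed.

Theorem corollary3p5 (R : realType) (n l : nat) (p : slp R n l)
    (K : set 'cV[R]_n) (xo : 'cV[R]_n) (k : nat)
    (A : 'I_k.+1 -> 'M[R]_n) (b : 'I_k.+1 -> 'cV[R]_n) :
  admissible p ->
  compact K -> convex_set K -> interior K !=set0 ->
  K xo ->
  composed_of (tangent_model p xo) A b ->
  (forall i, A i \in unitmx) ->
  coherently_oriented A ->
  let D := K `&` eball xo (quot_or_infty (rho A) (gamma_fun K p)) in
  (forall z, D z -> set_surj setT setT (tangent_model p z)) /\
  (forall zc zh, D zc -> D zh -> set_surj setT setT (secant_model p zc zh)).
Proof.
move=> ap Kc Kv _ Kxo GA Au co D.
suff surj zc zh : D zc -> D zh -> set_surj setT setT (secant_model p zc zh).
  by split=> // z Dz; exact: surj.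
(* In dimension 0 the target is a single point; the positivity of [rho A] requires positive
   dimension. *)
case: n p K xo A b ap Kc Kv Kxo GA Au co @D zc zh
  => [|n] p K xo A b ap Kc Kv Kxo GA Au co D zc zh.
  by move=> _ _ y _; exists 0 => //; apply/colP => -[].
move=> [Kzc Bzc] [Kzh Bzh] y _.
pose d := Num.max `|xo - zc| `|xo - zh|.
have dc : `|xo - zc| <= d by rewrite le_max lexx.
have dh : `|xo - zh| <= d by rewrite le_max lexx orbT.
have d0 : 0 <= d := le_trans (normr_ge0 _) dc.
have g0 : 0 <= gamma_fun K p by exact: bigmax_ge_id.
have gd : gamma_fun K p * d < rho A.
  move: Bzc Bzh; rewrite /eball /quot_or_infty /=.
  case: eqP => [-> _ _|/eqP gN0]; first by rewrite mul0r rho_gt0.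
  rewrite !lte_fin => hc hh; rewrite mulrC -ltr_pdivlMr; last by rewrite lt_neqAle eq_sym gN0.
  by rewrite gt_max hc.
have [C HC] := secant_model_dist ap Kc Kv Kxo Kzc Kzh dc dh.
have [x Hx] := @coherent_surjective R n k.+1 (tangent_model p xo) (secant_model p zc zh)
  A b (rho A) _ C (@continuous_secant_model _ _ _ p xo xo)
  (@continuous_secant_model _ _ _ p zc zh)
  GA Au co
  (fun i x => rho_le x (Au i)) HC (mulr_ge0 g0 d0) gd y.
by exists x.
Qed.
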